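(* Let $\beta=\max\{\beta_k\}_{k=1}^{n-1}$ and assume that \[ \alpha\in \left(0,\tfrac{2}{\beta}\right),\qquad \gamma\in \left(0,\tfrac{1-\frac{1}{2}\alpha\beta}{\alpha\|L\|^2}\right),\qquad \lambda\in \left(0,1-\tfrac{\alpha\beta}{2}\right), \] and set $\theta=\dfrac{\lambda}{1-\frac{\alpha\beta}{2}}$. Let $\bm{z}^0=(z_1^0,\dots,z_{n-1}^0)\in\mathcal{H}^{n-1}$ and $v^0\in\mathcal{G}$ be arbitrary and, for every $k\ge 0$, let \[ \begin{cases} x_1^k=J_{\alpha A_1}(z_1^k),\\ x_i^k=J_{\alpha A_i}\left(z_i^k+x_{i-1}^k-z_{i-1}^k-\alpha C_{i-1}x_{i-1}^k\right), & i=2,\dots,n-1,\\ x_n^k=J_{\alpha A_n}\left(x_1^k+x_{n-1}^k-z_{n-1}^k-\alpha L^*(\gamma Lx_1^k-v^k)-\alpha C_{n-1}x_{n-1}^k\right),\\ y^k=J_{B/\gamma}\left(L(x_1^k+x_n^k)-\frac{v^k}{\gamma}\right), \end{cases} \] \[ z_i^{k+1}=z_i^k+\lambda(x_{i+1}^k-x_i^k)\quad (i=1,\dots,n-1),\qquad v^{k+1}=v^k+\lambda\gamma(y^k-Lx_n^k). \] Write $\bm z^k=(z_1^k,\dots,z_{n-1}^k)$ and $\bm x^k=(x_1^k,\dots,x_n^k)$. Then the following assertions hold: (i) The sequence $(\bm{z}^k,v^k)_{k}$ converges weakly to some $(\bm{\bar z},\bar v)=(\bar z_1,\dots,\bar z_{n-1},\bar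 v)\in \mathrm{Fix}\,T$. (ii) The sequence $(\bm{x}^k,y^k)_{k}$ converges weakly to $(\bar x,\dots,\bar x,L\bar x)$, where $\bar x$ belongs to $\mathcal{P}$. (iii) For every $i\in\{1,\dots,n\}$, the sequence $(\gamma Lx_i^k-v^k)_{k}$ converges weakly to $\gamma L\bar x-\bar v\in\mathcal{D}$. (iv) $\|(\bm z^k,v^k)-(\bm z^{k+1},v^{k+1})\|_{\frac{\alpha}{\gamma}}=o\left(\dfrac{\theta}{\sqrt{\sigma_k}}\right)$, where $\sigma_k=\theta(1-\theta)(k+1)$. (v) If there exists an index $i\in\{1,\dots,n\}$ such that the operator $A_i$ is uniformly monotone, then the sequence $(x_i^k)_k$ converges strongly to $\bar x$, where $\bar x$ belongs to $\mathcal{P}$.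
   Context: $\mathcal{H}$ and $\mathcal{G}$ are real Hilbert spaces, $n\ge 2$; $A_1,\dots,A_n:\mathcal{H}\to 2^{\mathcal{H}}$ and $B:\mathcal{G}\to 2^{\mathcal{G}}$ are maximally monotone; for each $k\in\{1,\dots,n-1\}$, $C_k:\mathcal{H}\to\mathcal{H}$ is $\frac{1}{\beta_k}$-cocoercive with $\beta_k>0$, i.e. $\langle x-y,C_kx-C_ky\rangle\ge\frac1{\beta_k}\|C_kx-C_ky\|^2$ for all $x,y$; $L:\mathcal{H}\to\mathcal{G}$ is a bounded linear operator with adjoint $L^*$. For a set-valued operator $A$ and $\gamma>0$, $J_{\gamma A}=(I+\gamma A)^{-1}$ is the resolvent (and $J_{B/\gamma}=(I+\frac1\gamma B)^{-1}$). The operator $A$ is uniformly monotone if there is an increasing function $\phi_A:[0,+\infty)\to[0,+\infty]$ vanishing only at $0$ with $\langle x-y,u-w\rangle\ge\phi_A(\|x-y\|)$ whenever $u\in Ax$, $w\in Ay$. $\mathcal{P}$ is the set of $x\in\mathcal{H}$ with $0\in\sum_{i=1}^nA_ix+L^*BLx+\sum_{k=1}^{n-1}C_kx$. $\mathcal{D}$ is the set of $u\in\mathcal{G}$ with $0\in -L\left(\sum_{i=1}^nA_i+\sum_{k=1}^{n-1}C_k\right)^{-1}(-L^*u)+B^{-1}u$. $T:\mathcal{H}^{n-1}\times\mathcal{G}\to\mathcal{H}^{n-1}\times\mathcal{G}$ is the one-step map of the iteration, i.e. the map (not depending on $k$) with $(\bm z^{k+1},v^{k+1})=T(\bm z^k,v^k)$,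 and $\mathrm{Fix}\,T$ is its set of fixed points. The norm is $\|(z_1,\dots,z_{n-1},v)\|_{\frac{\alpha}{\gamma}}^2=\sum_{i=1}^{n-1}\|z_i\|^2+\frac{\alpha}{\gamma}\|v\|^2$.
   Formalization: The formal theorem additionally assumes that the primal solution set P is non-empty; without this the claim fails (e.g. A_1 constantly 1 on the real line and all other A_i, B and C_k equal to 0), since the conclusion asserts that x-bar belongs to P. *)

(* Defs.v *)
From HB Require Import structures.
From mathcomp Require Import all_boot all_order all_algebra.
From mathcomp Require Import sesquilinear.
From mathcomp Require Import all_classical all_reals all_analysis.

Set Implicit Arguments.
Unset Strict Implicit.
Unset Printing Implicit Defensive.

Import Order.TTheory GRing.Theory Num.Theory.
Import numFieldNormedType.Exports.

Local Open Scope classical_set_scope.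
Local Open Scope ring_scope.

(* A real Hilbert space is a complete normed space whose norm is induced by an
   inner product. *)
HB.mixin Record isHilbert (R : realType) H of CompleteNormedModule R H := {
  hilbert_dot : {dot H for (@idfun R)} ;
  hilbert_dotE : forall x : H, hilbert_dot x x = `|x| ^+ 2
}.

#[short(type="hilbertType")]
HB.structure Definition Hilbert (R : realType) :=
  {H of isHilbert R H & CompleteNormedModule R H}.

Definition inner (R : realType) (H : hilbertType R) (x y : H) : R :=
  hilbert_dot x y.

Definition weak_cvg (R : realType) (V : Type) (ip : V -> V -> R)
    (u : nat -> V) (l : V) : Prop :=
  forall w, ip (u k) w @[k --> \oo] --> ip l w.

(* The product Hilbert space H^p x G is carried by ('I_p -> H) * G.  The norms
   that the library puts on functions and pairs are not Hilbert norms, so the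
   inner product and the weighted norm are given here as plain functions. *)
Section ProductSpace.
Variables (R : realType) (H G : hilbertType R) (p : nat).

Definition prod_inner (w w' : ('I_p -> H) * G) : R :=
  \sum_i inner (w.1 i) (w'.1 i) + inner w.2 w'.2.

Definition weighted_norm (c : R) (w : ('I_p -> H) * G) : R :=
  Num.sqrt (\sum_i `|w.1 i| ^+ 2 + c * `|w.2| ^+ 2).

End ProductSpace.

Section BoundedLinear.
Variables (R : realType) (H G : hilbertType R).

Definition opnorm (L : H -> G) : R :=
  sup [set `|L x| | x in [set x : H | `|x| <= 1]].

(* Unique and total for bounded linear L, by the Riesz theorem. *)
Definition adjoint (L : H -> G) (u : G) : H :=
  xget 0 [set w | forall x, inner x w = inner (L x) u].

End BoundedLinear.

Section SetValued.
Variables (R : realType) (H : hilbertType R).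
Implicit Types (A : H -> set H) (X Y : set H).

Definition set_add X Y : set H := [set x + y | x in X & y in Y].

Definition op_inv (U V : Type) (A : U -> set V) (v : V) : set U :=
  [set x | A x v].

Definition monotone A : Prop :=
  forall x y u w, A x u -> A y w -> 0 <= inner (x - y) (u - w).

Definition maximally_monotone A : Prop :=
  monotone A /\
  forall A', monotone A' -> (forall x, A x `<=` A' x) ->
    forall x, A' x `<=` A x.

Definition uniformly_monotone A : Prop :=
  exists phi : R -> \bar R,
    [/\ forall t, 0 <= t -> (0 <= phi t)%E,
        forall s t, 0 <= s -> s <= t -> (phi s <= phi t)%E,
        forall t, 0 <= t -> (phi t = 0%E <-> t = 0) &
        forall x y u w, A x u -> A y w ->
          (phi `|x - y|%R <= (inner (x - y)%R (u - w)%R)%:E)%E].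

Definition cocoercive (b : R) (C : H -> H) : Prop :=
  forall x y, b * `|C x - C y| ^+ 2 <= inner (x - y) (C x - C y).

Definition resolvent (c : R) A : H -> set H :=
  op_inv (fun x => set_add [set x] [set c *: a | a in A x]).

(* The resolvent of a maximally monotone operator is single-valued and
   everywhere defined; J c A is the corresponding map. *)
Definition J (c : R) A (z : H) : H := xget 0 (resolvent c A z).

End SetValued.

(* There are n = m.+2 operators A and n - 1 = m.+1 operators C.  Indices start
   at 0: A i, C i, z i, x i stand for A_(i+1), C_(i+1), z_(i+1), x_(i+1). *)
Section Algorithm.
Variables (R : realType) (H G : hilbertType R) (m : nat).
Variables (A : 'I_m.+2 -> H -> set H) (B : G -> set G).
Variables (C : 'I_m.+1 -> H -> H) (L : H -> G).

(* x |-> \sum_i A_i x + \sum_k C_k x *)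
Definition sumAC (x : H) : set H :=
  set_add (\big[@set_add R H/[set 0]]_i A i x) [set \sum_k C k x].

Definition primal : set H :=
  [set x | set_add (set_add (\big[@set_add R H/[set 0]]_i A i x)
                            (adjoint L @` B (L x)))
                   [set \sum_k C k x] 0].

Definition dual : set G :=
  [set u | set_add [set - L x | x in op_inv sumAC (- adjoint L u)]
                   (op_inv B u) 0].

Variables (alpha gamma lambda : R).

Fixpoint xrec (z : 'I_m.+1 -> H) (v : G) (j : nat) : H :=
  match j with
  | 0 => J alpha (A ord0) (z ord0)
  | j'.+1 =>
    let x1 := J alpha (A ord0) (z ord0) in
    let xp := xrec z v j' in
    let k : 'I_m.+1 := inord j' in
    if j' == m then
      J alpha (A ord_max)
        (x1 + xp - z k - alpha *: adjoint L (gamma *: L x1 - v)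
         - alpha *: C k xp)
    else
      J alpha (A (inord j'.+1))
        (z (inord j'.+1) + xp - z k - alpha *: C k xp)
  end.

Definition xstep (w : ('I_m.+1 -> H) * G) (i : 'I_m.+2) : H :=
  xrec w.1 w.2 i.

Definition ystep (w : ('I_m.+1 -> H) * G) : G :=
  J gamma^-1 B (L (xstep w ord0 + xstep w ord_max) - gamma^-1 *: w.2).

Definition T (w : ('I_m.+1 -> H) * G) : ('I_m.+1 -> H) * G :=
  (fun i => w.1 i + lambda *: (xstep w (lift ord0 i)
                               - xstep w (widen_ord (leqnSn _) i)),
   w.2 + (lambda * gamma) *: (ystep w - L (xstep w ord_max))).

End Algorithm.

Definition Fix (V : Type) (f : V -> V) : set V := [set w | f w = w].

(* Main.v *)
Require Import Defs.
From mathcomp Require Import all_boot all_order all_algebra.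
From mathcomp Require Import sesquilinear ring lra.
From mathcomp Require Import all_classical all_reals all_analysis.

Set Implicit Arguments.
Unset Strict Implicit.
Unset Printing Implicit Defensive.

Import Order.TTheory GRing.Theory Num.Theory.
Import numFieldNormedType.Exports.

Local Open Scope classical_set_scope.
Local Open Scope ring_scope.

(** Write [s_j = x_j - x_(j+1)] and [t = y - L x_n]. One step of the iteration
    is the same thing as a system of inclusions [a_i \in A_i x_i],
    [b \in B y], where the [a_i] and [b] are linear in the [z_j], [v], the [x_i],
    [y] and the [C_j x_j]; the step moves [z_j] by [- lambda s_j] and [v] by
    [lambda gamma t].

    The heart of the proof is a quadratic identity ([total_identity]). Add up the
    monotonicity products of all the [A_i], of [B] and of the [C_j] between two
    solutions of the system. Summation by parts and completion of squares turn
    this sum, times [alpha], into [sum_j <ds_j, dz_j> - alpha <dv, dt>] plus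
    [alpha sum_j <ds_j, dC_j>] plus a combination of squares. All the squares
    have negative coefficients except [|L (dx_1 - dx_n)|^2], which is absorbed by
    [|dx_1 - dx_n|^2] because [alpha gamma |L|^2 <= 1]; and Young's inequality
    lets cocoercivity absorb the products [<ds_j, dC_j>]. Hence the step is
    averaged for the weighted norm ([T_sqdist]): distances to fixed points
    decrease, [s_j] and [t] tend to [0], and the squared residuals are summable
    and nonincreasing, thus [o(1 / (k + 1))].

    Weak convergence is proved along ultrafilters finer than the filter of
    neighborhoods of infinity: by the Riesz theorem every bounded sequence
    converges weakly along each of them ([ultra_bweak]), and a sequence
    converges as soon as it converges to the same limit along all of them
    ([cvg_ultra]). Along such an ultrafilter the [x_i] have a common weak limit
    [xb]. The sum of the monotonicity products between the iterates and
    arbitrary points of the graphs passes to the limit ([total_cvg]), since its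
    only products of two weakly convergent factors add up to products with the
    null sequences [s_j] and [t]. The limit is a nonnegative sum whose terms can
    be chosen independently, so each term is nonnegative, and maximality puts
    the limits in all the graphs at once ([cluster_inclusions]): the cluster
    point is a fixed point and [xb] is a primal solution. Opial's argument shows
    that the cluster point does not depend on the ultrafilter
    ([cluster_unique]). Tested at the limit itself, the same sum tends to [0],
    so each product tends to [0]; when [A_i] is uniformly monotone this forces
    strong convergence of [x_i].

    Resolvents are single-valued by monotonicity and everywhere defined by
    Minty's theorem, which is proved by minimising half the square norm plus the
    Fitzpatrick function ([minty]). The Riesz theorem follows from the same
    minimisation principle ([proximal_point]). *)

(** * Scalar products *)

Section InnerProduct.
Variables (R : realType) (H : hilbertType R).
Implicit Types x y z : H.

Lemma innerC x y : inner x y = inner y x.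
Proof.
by rewrite /inner (hermitian_subproof (s := hilbert_dot) x y) expr0 mul1r.
Qed.

Lemma innerDl x y z : inner (x + y) z = inner x z + inner y z.
Proof. exact: linearDl. Qed.

Lemma innerZl a x z : inner (a *: x) z = a * inner x z.
Proof. exact: linearZl_LR. Qed.

Lemma innerDr x y z : inner z (x + y) = inner z x + inner z y.
Proof. by rewrite innerC innerDl ![inner _ z]innerC. Qed.

Lemma innerZr a x z : inner z (a *: x) = a * inner z x.
Proof. by rewrite innerC innerZl innerC. Qed.

Lemma innerNl x z : inner (- x) z = - inner x z.
Proof. by rewrite -scaleN1r innerZl mulN1r. Qed.

Lemma innerNr x z : inner z (- x) = - inner z x.
Proof. by rewrite innerC innerNl innerC. Qed.

Lemma inner0l z : inner (0 : H) z = 0.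
Proof. by rewrite -(scale0r (0 : H)) innerZl mul0r. Qed.

Lemma inner0r z : inner z (0 : H) = 0.
Proof. by rewrite innerC inner0l. Qed.

Definition innerE :=
  (innerDl, innerDr, innerNl, innerNr, innerZl, innerZr, inner0l, inner0r).

Lemma inner_suml (I : Type) (r : seq I) (P : pred I) (F : I -> H) z :
  inner (\sum_(i <- r | P i) F i) z = \sum_(i <- r | P i) inner (F i) z.
Proof.
by elim/big_ind2: _ => [|? ? ? ? <- <-|//]; rewrite ?inner0l ?innerDl.
Qed.

Lemma inner_sumr (I : Type) (r : seq I) (P : pred I) (F : I -> H) z :
  inner z (\sum_(i <- r | P i) F i) = \sum_(i <- r | P i) inner z (F i).
Proof. by rewrite innerC inner_suml; under eq_bigr do rewrite innerC. Qed.

Lemma inner_norm x : inner x x = `|x| ^+ 2.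
Proof. exact: hilbert_dotE. Qed.

Lemma inner_ge0 x : 0 <= inner x x.
Proof. by rewrite inner_norm sqr_ge0. Qed.

Lemma inner_eq0 x : inner x x = 0 -> x = 0.
Proof. by rewrite inner_norm => /eqP; rewrite sqrf_eq0 normr_eq0 => /eqP. Qed.

Lemma inner_inj x y : (forall z, inner x z = inner y z) -> x = y.
Proof.
move=> e; apply/eqP; rewrite -subr_eq0; apply/eqP/inner_eq0.
by rewrite innerDl innerNl e subrr.
Qed.

(** The square norm of [|y| x - |x| y], which is nonnegative, is
    [2 |x| |y| (|x| |y| - <x, y>)]. *)
Lemma cauchy_schwarz x y : inner x y <= `|x| * `|y|.
Proof.
have [->|x0] := eqVneq x 0; first by rewrite inner0l normr0 mul0r.
have [->|y0] := eqVneq y 0; first by rewrite inner0r normr0 mulr0.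
have := inner_ge0 (`|y| *: x - `|x| *: y).
rewrite !innerE !inner_norm [inner y x]innerC => h.
have xy0 : 0 < `|x| * `|y| by rewrite mulr_gt0 ?normr_gt0.
by rewrite -(ler_pM2l xy0); lra.
Qed.

Lemma cauchy_schwarz_abs x y : `|inner x y| <= `|x| * `|y|.
Proof.
by rewrite ler_norml cauchy_schwarz andbT lerNl -innerNl
           (le_trans (cauchy_schwarz _ _)) ?normrN.
Qed.

(** The square norm of [y - (b / 2) x], divided by [b]. *)
Lemma inner_young x y (b : R) : 0 < b ->
  inner x y <= b^-1 * `|y| ^+ 2 + b / 4 * `|x| ^+ 2.
Proof.
move=> b0; have := inner_ge0 (y - (b / 2) *: x).
rewrite !innerE [inner y x]innerC !inner_norm => h.
by rewrite -(ler_pM2l b0) mulrDr mulrA divff ?gt_eqF // mul1r; lra.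
Qed.

End InnerProduct.

(** * Minimisation of a convex function plus half the square norm *)

Section ProximalPoint.
Variable R : realType.

Lemma cauchy_of_sq_bound (V : completeNormedModType R) (u : nat -> V) (c : R) :
  (forall n k, `|u n - u k| ^+ 2 <= c * (n.+1%:R^-1 + k.+1%:R^-1)) ->
  cvgn u.
Proof.
move=> hu; apply/cauchy_cvgP/cauchy_exP => e e0.
have c0 : 0 <= c.
  by have := hu 0%N 0%N; rewrite subrr normr0 expr0n /= invr1; lra.
have e20 : 0 < e ^+ 2 by rewrite exprn_gt0.
have [N _ hN] := nbhs_infty_gtr (c * 2 / e ^+ 2).
have {hN} := hN N (leqnn N); rewrite /= => hN.
exists (u N), N => //= n /= Nn; rewrite -ball_normE /=.
rewrite -(@ltr_pXn2r _ 2) ?nnegrE ?normr_ge0 ?(ltW e0) //.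
apply: (le_lt_trans (hu N n)).
have inv_le : (n.+1%:R^-1 : R) <= N.+1%:R^-1.
  by rewrite lef_pV2 ?posrE ?ltr0Sn // ler_nat.
apply: (@le_lt_trans _ _ (c * (2 * N.+1%:R^-1))).
  by rewrite ler_wpM2l // mulr_natl mulr2n lerD2l.
have N0 : 0 < N.+1%:R :> R by rewrite ltr0Sn.
rewrite mulrA ltr_pdivrMr // [_ ^+ 2 * _]mulrC -ltr_pdivrMr //.
by rewrite (lt_le_trans hN) // ler_nat.
Qed.

Variables H K : hilbertType R.

(** The epigraph form of the variational inequality for the sum of a convex
    lower semicontinuous function of two variables and of half the square norm:
    [E x u r] stands for [f (x, u) <= r].  A minimising sequence is Cauchy by
    the parallelogram law, and the first-order condition at the minimiser is
    read off along segments. *)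
Lemma proximal_point (E : H -> K -> R -> Prop) (b : R) :
  (exists x u r, E x u r) ->
  (forall x u r, E x u r ->
     b <= r + 2^-1 * (`|x| ^+ 2 + `|u| ^+ 2)) ->
  (forall x u r x' u' r' (t : R), E x u r -> E x' u' r' -> 0 <= t <= 1 ->
     E (x + t *: (x' - x)) (u + t *: (u' - u)) (r + t * (r' - r))) ->
  (forall (xs : nat -> H) (us : nat -> K) (rs : nat -> R) x u r,
     (forall n, E (xs n) (us n) (rs n)) ->
     xs @ \oo --> x -> us @ \oo --> u -> rs @ \oo --> r -> E x u r) ->
  exists x0 u0 r0, E x0 u0 r0 /\
    forall x u r, E x u r ->
      r0 <= r + inner x0 (x - x0) + inner u0 (u - u0).
Proof.
move=> [x1 [u1 [r1 E1]]] lb cvx cls.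
pose q x u (r : R) := r + 2^-1 * (`|x : H| ^+ 2 + `|u : K| ^+ 2).
have [mu [muP /choice[p pP]]] : exists mu,
    (forall x u r, E x u r -> mu <= q x u r) /\
    (forall n : nat, exists p : H * K * R,
      E p.1.1 p.1.2 p.2 /\ q p.1.1 p.1.2 p.2 < mu + n.+1%:R^-1).
  pose S := [set q p.1.1 p.1.2 p.2
            | p in [set p : H * K * R | E p.1.1 p.1.2 p.2]].
  have Sinf : has_inf S.
    split; first by exists (q x1 u1 r1), (x1, u1, r1).
    by exists b => _ [[[x u] r] /= Ex <-]; exact: lb.
  exists (inf S); split=> [x u r Ex|n].
    by apply: (ge_inf Sinf.2); exists (x, u, r).
  have n0 : 0 < n.+1%:R^-1 :> R by rewrite invr_gt0 ltr0Sn.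
  have [_ [[[x u] r] /= Ex <-] hlt] := inf_adherent n0 Sinf.
  by exists (x, u, r).
have para (V : hilbertType R) (a c : V) :
    `|a - c| ^+ 2 = 2 * `|a| ^+ 2 + 2 * `|c| ^+ 2
                    - 4 * `|a + 2^-1 *: (c - a)| ^+ 2.
  by rewrite -!inner_norm !innerE [inner c a]innerC; field.
pose xs n := (p n).1.1; pose us n := (p n).1.2; pose rs n := (p n).2.
(* The midpoint of two almost minimisers cannot do better than [mu]. *)
have gap n k : `|xs n - xs k| ^+ 2 + `|us n - us k| ^+ 2
               <= 4 * (n.+1%:R^-1 + k.+1%:R^-1).
  have [En qn] := pP n; have [Ek qk] := pP k.
  have half : 0 <= (2^-1 : R) <= 1 by apply/andP; split; lra.
  have := muP _ _ _ (cvx _ _ _ _ _ _ _ En Ek half).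
  move: qn qk; rewrite /q /xs /us /= !para.
  by move: n.+1%:R^-1 k.+1%:R^-1 => dn dk; lra.
have xsc : cvgn xs.
  apply: (@cauchy_of_sq_bound _ _ 4) => n k.
  by apply: le_trans (gap n k); rewrite lerDl sqr_ge0.
have usc : cvgn us.
  apply: (@cauchy_of_sq_bound _ _ 4) => n k.
  by apply: le_trans (gap n k); rewrite lerDr sqr_ge0.
pose x0 := limn xs; pose u0 := limn us.
pose r0 := mu - 2^-1 * (`|x0| ^+ 2 + `|u0| ^+ 2).
have nsq (V : normedModType R) (f : nat -> V) l :
    f n @[n --> \oo] --> l -> `|f n| ^+ 2 @[n --> \oo] --> `|l| ^+ 2.
  move=> fl; rewrite expr2; under eq_fun do rewrite expr2.
  by apply: cvgM; exact: cvg_norm.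
have qc : q (xs n) (us n) (rs n) @[n --> \oo] --> mu.
  apply: (@squeeze_cvgr _ _ _ _ (fun=> mu) (fun n => mu + n.+1%:R^-1)).
  - near=> n; have [En qn] := pP n; rewrite (ltW qn) andbT; exact: muP.
  - exact: cvg_cst.
  - rewrite -[X in _ --> X]addr0.
    by apply: cvgD; [exact: cvg_cst|exact: cvg_harmonic].
have rc : rs n @[n --> \oo] --> r0.
  have -> : rs = fun n => q (xs n) (us n) (rs n)
                          - 2^-1 * (`|xs n| ^+ 2 + `|us n| ^+ 2).
    by apply/funext => n; rewrite /q addrK.
  apply: cvgB => //; apply: cvgM; first exact: cvg_cst.
  by apply: cvgD; exact: nsq.
have E0 : E x0 u0 r0 by apply: (cls xs us rs) => // n; have [] := pP n.
exists x0, u0, r0; split=> // x u r Exu.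
pose s := `|x - x0| ^+ 2 + `|u - u0| ^+ 2.
pose d := r - r0 + inner x0 (x - x0) + inner u0 (u - u0).
suff : 0 <= d by rewrite /d; lra.
have s0 : 0 <= s by rewrite addr_ge0 ?sqr_ge0.
have dt t : 0 < t <= 1 -> 0 <= d + t * s.
  move=> /andP[t0 t1].
  have h : 0 <= t <= 1 by rewrite t1 ltW.
  have := muP _ _ _ (cvx _ _ _ _ _ _ _ E0 Exu h).
  rewrite /q -!inner_norm !innerDl !innerDr !innerZl !innerZr.
  rewrite ![inner (_ - _) x0]innerC ![inner (_ - _) u0]innerC.
  rewrite -/mu /d /s -!inner_norm /r0 -!inner_norm => h2.
  rewrite -(@ler_pM2l _ t) // mulr0.
  have ss : 0 <= t * t * (inner (x - x0) (x - x0) + inner (u - u0) (u - u0)).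
    by rewrite mulr_ge0 ?addr_ge0 ?inner_ge0 // mulr_ge0 // ltW.
  lra.
rewrite leNgt; apply/negP => d0.
(* A step of this length makes the quadratic term at most half of [- d]. *)
have [t /andP[t0 t1] ts] : exists2 t, 0 < t <= 1 & d + t * s < 0.
  have s1 : 0 < s + 1 by lra.
  exists (Num.min 1 (- d / (2 * (s + 1)))).
    rewrite lt_min ltr01 /= divr_gt0 ?mulr_gt0 ?oppr_gt0 //=.
    by rewrite ge_min lexx.
  apply: (@le_lt_trans _ _ (d + - d / (2 * (s + 1)) * s)).
    by rewrite lerD2l ler_wpM2r // ge_min lexx orbT.
  have : - d / (2 * (s + 1)) * s <= - d / 2.
    rewrite invfM mulrA -mulrA ler_piMr //; first by lra.
    by rewrite mulrC ler_pdivrMr // mul1r; lra.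
  lra.
by have := dt t; rewrite t0 t1 => /(_ isT); lra.
Unshelve. all: by end_near. Qed.

End ProximalPoint.

(** * Limits *)

Section Limits.
Variables (R : realType) (T : Type) (F : set_system T).
Context {FF : ProperFilter F}.

Lemma cvg_lipschitz (V W : normedModType R) (f : T -> V) (g : T -> W) a b M :
  (forall k, `|g k - b| <= M * `|f k - a|) ->
  f k @[k --> F] --> a -> g k @[k --> F] --> b.
Proof.
move=> gf fa; apply/cvgrPdistC_le => e e0.
have M1 : 0 < `|M| + 1 by rewrite ltr_wpDl.
apply: filterS (cvgr_distC_le _ _ fa _ (divr_gt0 e0 M1)) => k hk.
apply: (le_trans (gf k)); rewrite ler_pdivlMr // mulrC in hk.
apply: le_trans hk; rewrite ler_wpM2r //.
by rewrite (le_trans (ler_norm M)) // lerDl.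
Qed.

Lemma cvg_inner (H : hilbertType R) (u : T -> H) (l w : H) :
  u k @[k --> F] --> l -> inner (u k) w @[k --> F] --> inner l w.
Proof.
apply: (@cvg_lipschitz _ _ _ _ _ _ `|w|) => k.
by rewrite -innerNl -innerDl mulrC cauchy_schwarz_abs.
Qed.

Lemma cvg_sumr (I : finType) (f : I -> T -> R) (l : I -> R) :
  (forall i, f i k @[k --> F] --> l i) ->
  \sum_i f i k @[k --> F] --> \sum_i l i.
Proof.
by move=> h; apply: cvg_big => [|i _]; [exact: add_continuous|exact: h].
Qed.

Lemma cvg0_of_sqr_norm (V : normedModType R) (u : T -> V) :
  `|u k| ^+ 2 @[k --> F] --> (0 : R) -> u k @[k --> F] --> (0 : V).
Proof.
move=> h; apply/cvgr0Pnorm_le => e e0.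
have e20 : 0 < e ^+ 2 by rewrite exprn_gt0.
apply: filterS (cvgr0_norm_le _ h _ e20) => k hk.
by rewrite -(@ler_pXn2r _ 2) ?nnegrE // ?(ltW e0) // -[X in X <= _]ger0_norm.
Qed.

Lemma norm_le_of_sqr (V : normedModType R) (u : V) (d : R) :
  `|u| ^+ 2 <= d -> `|u| <= d + 1.
Proof. by have := sqr_ge0 (`|u| - 2^-1); rewrite sqrrB; lra. Qed.

End Limits.

(** * Representation of bounded linear functionals *)

Section Riesz.
Variables (R : realType) (H : hilbertType R).

(** The vector that represents [f] minimises [x |-> |x|^2 / 2 - f x]; the second
    variable of [proximal_point] is left free, so that it vanishes at the
    minimiser. *)
Lemma riesz (f : H -> R) (M : R) :
  (forall x y, f (x + y) = f x + f y) -> (forall a x, f (a *: x) = a * f x) ->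
  (forall x, `|f x| <= M * `|x|) -> exists w, forall x, f x = inner x w.
Proof.
move=> fD fZ fM.
have fN x : f (- x) = - f x by rewrite -scaleN1r fZ mulN1r.
have fB x y : f (x - y) = f x - f y by rewrite fD fN.
have cf (xs : nat -> H) x : xs @ \oo --> x -> f (xs n) @[n --> \oo] --> f x.
  by apply: (@cvg_lipschitz _ _ _ _ _ _ _ _ _ _ M) => n; rewrite -fB.
pose E (x u : H) (r : R) := - f x <= r.
have [|x u r|x u r x' u' r' t|xs us rs x u r|x0 [u0 [r0 [E0 min0]]]] :=
    @proximal_point _ _ _ E (- (2^-1 * M ^+ 2)).
- by exists 0, 0, (- f 0); rewrite /E.
- rewrite /E => fr; have := fM x; have := ler_norm (f x).
  have := sqr_ge0 (`|x| - M); have := sqr_ge0 `|u|; rewrite sqrrB.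
  lra.
- rewrite /E => fr fr' /andP[t0 t1]; rewrite fD fZ fB.
  have : 0 <= t * (r' + f x') by rewrite mulr_ge0 //; lra.
  have : 0 <= (1 - t) * (r + f x) by rewrite mulr_ge0 //; lra.
  lra.
- rewrite /E => h /cf xsx _ rsr; apply: (ler_cvg_to (cvgN xsx) rsr).
  by apply: nearW => n; exact: h.
have fr0 : - f x0 = r0.
  apply/eqP; rewrite eq_le; apply/andP; split; first exact: E0.
  by have := min0 x0 u0 (- f x0) (lexx _); rewrite !subrr !inner0r !addr0.
exists x0 => d; apply/eqP; rewrite eq_le.
(* Moving from [x0] by [d] and by [- d] gives the two inequalities. *)
have h d' := min0 (x0 + d') u0 (- f (x0 + d')) (lexx _).
have := h d; have := h (- d).
rewrite !fD !fN -fr0 !subrr !inner0r !addr0.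
rewrite ![x0 + _]addrC !addrK innerNr [inner d x0]innerC => h1 h2.
by apply/andP; split; lra.
Qed.

End Riesz.

(** * Resolvents of maximally monotone operators *)

Section Minty.
Variables (R : realType) (H : hilbertType R).
Implicit Type A : H -> set H.

(** A point monotonically related to the whole graph can be added to it. *)
Lemma maximallyP A : maximally_monotone A <->
  Defs.monotone A /\
  forall x u, (forall y v, A y v -> 0 <= inner (x - y) (u - v)) -> A x u.
Proof.
split=> -[mA maxA]; split=> //.
  move=> x u rel.
  pose A' y := A y `|` [set v | y = x /\ v = u].
  apply: (maxA A') => [y z v w|y v Av|]; first last.
  - by right.
  - by left.
  case=> [Av|[-> ->]] [Aw|[-> ->]]; first exact: mA.
  - by rewrite -[y - x]opprB -[v - u]opprB innerNl innerNr opprK rel.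
  - exact: rel.
  - by rewrite !subrr inner0l.
by move=> A' mA' sA x u A'u; apply: maxA => y v Av; apply: mA' => //; exact: sA.
Qed.

Lemma maximally_monotone_nonempty A :
  maximally_monotone A -> exists x u, A x u.
Proof.
move=> /maximallyP[_ maxA]; apply: contrapT => nA; apply: (nA).
by exists 0, 0; apply: maxA => y v Av; case: nA; exists y, v.
Qed.

(** The surjectivity of [I + A]: half the square norm plus the Fitzpatrick
    function [(x, u) |-> sup (<x, v> + <y, u> - <y, v>)], the supremum being
    over the graph of [A], has a minimiser [(x0, u0)].  The Fitzpatrick function
    dominates [<x, u>] and equals it on the graph, so the variational inequality
    at the minimiser says that [(- u0, - x0)] is monotonically related to [A],
    hence in its graph; testing the inequality at this very point gives
    [u0 = - x0]. *)
Lemma minty A : maximally_monotone A -> exists x, A x (- x).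
Proof.
move=> mA; have [y1 [v1 A1]] := maximally_monotone_nonempty mA.
have /maximallyP[monA maxA] := mA.
pose E x u r := forall y v, A y v -> inner x v + inner y u - inner y v <= r.
have Eself y v : A y v -> E y v (inner y v).
  move=> Ay x u Au; have := monA _ _ _ _ Ay Au.
  by rewrite !innerE; lra.
have Eabove x u r : E x u r -> inner x u <= r.
  move=> Exu; rewrite leNgt; apply/negP => lt.
  have Axu : A x u.
    by apply: maxA => y v Av; have := Exu _ _ Av; rewrite !innerE; lra.
  by have := Exu _ _ Axu; lra.
have [|x u r Exu|x u r x' u' r' t Exu Exu'|xs us rs x u r Es xsx usu rsr|
      x0 [u0 [r0 [E0 min0]]]] := @proximal_point _ _ _ E 0.
- by exists y1, v1, (inner y1 v1); exact: Eself.
- have := Eabove _ _ _ Exu; have := inner_ge0 (x + u).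
  by rewrite !innerE !inner_norm [inner u x]innerC; lra.
- move=> /andP[t0 t1] y v Av; have := Exu _ _ Av; have := Exu' _ _ Av.
  rewrite !innerE => h1 h2.
  have : 0 <= t * (r' - (inner x' v + inner y u' - inner y v)).
    by rewrite mulr_ge0 //; lra.
  have : 0 <= (1 - t) * (r - (inner x v + inner y u - inner y v)).
    by rewrite mulr_ge0 //; lra.
  lra.
- move=> y v Av; rewrite [inner y u]innerC.
  have lim : inner (xs n) v + inner (us n) y - inner y v @[n --> \oo] -->
             inner x v + inner u y - inner y v.
    by apply: cvgB; [apply: cvgD; exact: cvg_inner|exact: cvg_cst].
  apply: (ler_cvg_to lim rsr); apply: nearW => n.
  by rewrite [inner _ y]innerC; exact: Es.
have rel y v : A y v -> `|x0 + u0| ^+ 2 <= inner (y + u0) (v + x0).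
  move=> Av; have := min0 _ _ _ (Eself _ _ Av); have := Eabove _ _ _ E0.
  by rewrite -!inner_norm !innerE [inner y x0]innerC [inner u0 x0]innerC; lra.
have A0 : A (- u0) (- x0).
  apply: maxA => y v Av; have := rel _ _ Av; have := sqr_ge0 `|x0 + u0|.
  by rewrite !innerE; lra.
have := rel _ _ A0; rewrite !addNr inner0l -inner_norm => h.
have /inner_eq0/eqP : inner (x0 + u0) (x0 + u0) = 0.
  by apply/eqP; rewrite eq_le h inner_ge0.
by rewrite addr_eq0 => /eqP x0E; exists (- u0); rewrite -{2}x0E.
Qed.

Lemma resolventP c A x z : 0 < c ->
  resolvent c A z x <-> A x (c^-1 *: (z - x)).
Proof.
move=> c0; have cn : c != 0 by rewrite gt_eqF.
split=> [[_ -> [_ [a Aa <-] <-]]|Ax].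
  by rewrite addrAC subrr add0r scalerA mulVf // scale1r.
exists x => //; exists (z - x); last by rewrite addrC subrK.
by exists (c^-1 *: (z - x)) => //; rewrite scalerA divff // scale1r.
Qed.

Lemma J_unique c A x z : 0 < c -> Defs.monotone A ->
  A x (c^-1 *: (z - x)) -> J c A z = x.
Proof.
move=> c0 mA Ax; have /(resolventP _ _ _ c0) rx := Ax.
apply: (xget_unique _ rx) => y /(resolventP _ _ _ c0) Ay.
have := mA _ _ _ _ Ay Ax.
rewrite -scalerBr opprB [_ + (x - z)]addrC addrA subrK.
rewrite innerZr pmulr_rge0 ?invr_gt0 // -[x - y]opprB innerNr oppr_ge0 => h.
apply/eqP; rewrite -subr_eq0; apply/eqP/inner_eq0/eqP.
by rewrite eq_le h inner_ge0.
Qed.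

(** [I + c A] is onto because [y |-> c A y - z] is maximally monotone. *)
Lemma J_resolvent c A z : 0 < c -> maximally_monotone A ->
  A (J c A z) (c^-1 *: (z - J c A z)).
Proof.
move=> c0 /maximallyP[mA maxA]; apply/resolventP => //; apply: xgetPex.
have cn : c != 0 by rewrite gt_eqF.
have [|x Ax] := @minty (fun x u => A x (c^-1 *: (u + z))).
  apply/maximallyP; split=> [x y u w Au Aw|x u rel].
    have := mA _ _ _ _ Au Aw; rewrite -scalerBr innerZr pmulr_rge0 ?invr_gt0 //.
    by rewrite opprD addrACA subrr addr0.
  apply: maxA => y v Av.
  have := rel y (c *: v - z); rewrite subrK scalerA mulVf // scale1r.
  move=> /(_ Av); rewrite opprB addrA -{1}(@scalerKV _ _ c cn (u + z)).
  by rewrite -scalerBr innerZr pmulr_rge0.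
by exists x; apply/resolventP => //; rewrite addrC.
Qed.

End Minty.

(** * Bounded linear operators and their adjoints *)

Section BoundedLinear.
Variables (R : realType) (H G : hilbertType R) (L : {linear H -> G}).
Hypothesis hL : bounded_near L (nbhs (0 : H)).

Lemma bounded_linear_bound : exists2 M, 0 < M & forall x, `|L x| <= M * `|x|.
Proof. by have /linear_boundedP/pinfty_ex_gt0[M M0 hM] := hL; exists M. Qed.

Lemma opnorm_ge0 : 0 <= opnorm L.
Proof.
have [M M0 hM] := bounded_linear_bound.
apply: le_trans (normr_ge0 (L 0)) _; apply: ub_le_sup.
  exists M => _ [x /= x1 <-]; apply: (le_trans (hM x)).
  by rewrite -[X in _ <= X]mulr1 ler_pM2l.
by exists 0; rewrite //= normr0 ler01.
Qed.

Lemma opnormP x : `|L x| <= opnorm L * `|x|.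
Proof.
have [M M0 hM] := bounded_linear_bound.
have [->|x0] := eqVneq x 0; first by rewrite linear0 !normr0 mulr0.
have nx0 : 0 < `|x| by rewrite normr_gt0.
rewrite -ler_pdivrMr //; apply: ub_le_sup.
  exists M => _ [y /= y1 <-]; apply: (le_trans (hM y)).
  by rewrite -[X in _ <= X]mulr1 ler_pM2l.
exists (`|x|^-1 *: x) => /=.
  by rewrite normrZ gtr0_norm ?invr_gt0 // mulVf // gt_eqF.
by rewrite linearZ /= normrZ gtr0_norm ?invr_gt0 // mulrC.
Qed.

Lemma adjointP x u : inner x (adjoint L u) = inner (L x) u.
Proof.
have [M M0 hM] := bounded_linear_bound.
have [||y|w hw] := @riesz _ H (fun x => inner (L x) u) (M * `|u|).
- by move=> y z; rewrite linearD innerDl.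
- by move=> a y; rewrite linearZ innerZl.
- rewrite (le_trans (cauchy_schwarz_abs _ _)) // mulrAC ler_wpM2r //.
have : [set w | forall x, inner x w = inner (L x) u] (adjoint L u).
  by apply: xgetPex; exists w => y; rewrite hw.
by [].
Qed.

Lemma adjoint_bound : exists2 M, 0 < M & forall u, `|adjoint L u| <= M * `|u|.
Proof.
have [M M0 hM] := bounded_linear_bound; exists M => // u.
have [->|au0] := eqVneq (adjoint L u) 0.
  by rewrite normr0 mulr_ge0 // ltW.
rewrite -(@ler_pM2l _ `|adjoint L u|) ?normr_gt0 // -expr2 -inner_norm adjointP.
rewrite (le_trans (cauchy_schwarz _ _)) // mulrCA mulrA ler_wpM2r //.
Qed.

End BoundedLinear.

(** * Weak convergence along ultrafilters *)

(** Boundedness is part of the notion because, along an ultrafilter, weak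
    convergence does not imply it. *)
Definition bweak (R : realType) (H : hilbertType R) (F : set_system nat)
    (u : nat -> H) (l : H) :=
  (exists M, \forall k \near F, `|u k| <= M) /\
  (forall w, inner (u k) w @[k --> F] --> inner l w).

Section BoundedWeakConvergence.
Variables (R : realType) (F : set_system nat).
Context {FF : ProperFilter F}.
Variable H : hilbertType R.
Implicit Types (u v : nat -> H) (l w : H).

Lemma bweak_cst l : bweak F (fun=> l) l.
Proof.
by split=> [|w]; [exists `|l|; exact: nearW|exact: cvg_cst].
Qed.

Lemma bweakD u v l l' :
  bweak F u l -> bweak F v l' -> bweak F (fun k => u k + v k) (l + l').
Proof.
move=> [[M bu] cu] [[M' bv] cv]; split=> [|w].
  exists (M + M'); apply: filterS2 bu bv => k uk vk.
  by rewrite (le_trans (ler_normD _ _)) // lerD.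
by under eq_fun do rewrite innerDl; rewrite innerDl; apply: cvgD.
Qed.

Lemma bweak_adjointable (G : hilbertType R) (f : H -> G) (f' : G -> H) (M : R)
    u l :
  (forall x z, inner (f x) z = inner x (f' z)) ->
  (forall x, `|f x| <= M * `|x|) ->
  bweak F u l -> bweak F (fun k => f (u k)) (f l).
Proof.
move=> ff' fM [[B bu] cu]; split=> [|w].
  exists (`|M| * B); apply: filterS bu => k uk; apply: (le_trans (fM _)).
  by rewrite (le_trans (ler_wpM2r _ (ler_norm M))) // ler_wpM2l.
by under eq_fun do rewrite ff'; rewrite ff'; exact: cu.
Qed.

Lemma bweakZ a u l : bweak F u l -> bweak F (fun k => a *: u k) (a *: l).
Proof.
apply: (@bweak_adjointable _ _ (fun w => a *: w) `|a|) => [x w|x].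
  by rewrite innerZl innerZr.
by rewrite normrZ.
Qed.

Lemma bweakN u l : bweak F u l -> bweak F (fun k => - u k) (- l).
Proof.
rewrite -[- l]scaleN1r (_ : (fun k => - u k) = fun k => -1 *: u k).
  exact: bweakZ.
by apply/funext => k; rewrite scaleN1r.
Qed.

Lemma bweakB u v l l' :
  bweak F u l -> bweak F v l' -> bweak F (fun k => u k - v k) (l - l').
Proof. by move=> ul vl'; apply: bweakD => //; exact: bweakN. Qed.

Lemma bweak_strong u l : u k @[k --> F] --> l -> bweak F u l.
Proof.
move=> ul; split=> [|w]; last exact: cvg_inner.
exists (`|l| + 1); apply: filterS (cvgr_distC_le _ _ ul _ ltr01) => k hk.
by rewrite -(subrK l (u k)) addrC (le_trans (ler_normD _ _)) // lerD2l.
Qed.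

Lemma inner_null_bweak (e : nat -> H) u l :
  e k @[k --> F] --> (0 : H) -> bweak F u l ->
  inner (e k) (u k) @[k --> F] --> (0 : R).
Proof.
move=> e0 [[M bu] _]; have M1 : 0 < `|M| + 1 by rewrite ltr_wpDl.
apply/cvgr0Pnorm_le => r r0.
apply: filterS2 bu (cvgr0_norm_le _ e0 _ (divr_gt0 r0 M1)) => k uk ek.
rewrite (le_trans (cauchy_schwarz_abs _ _)) // -(divfK (lt0r_neq0 M1) r).
apply: ler_pM => //; apply: (le_trans uk).
by rewrite (le_trans (ler_norm M)) // lerDl.
Qed.

Lemma bweak_null_add (e : nat -> H) u l :
  e k @[k --> F] --> (0 : H) -> bweak F u l -> bweak F (fun k => u k + e k) l.
Proof. by move=> /bweak_strong e0 ul; rewrite -[l]addr0; exact: bweakD. Qed.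

(** Products of two weakly convergent sequences need not converge; but shifting
    the factors, or perturbing one of them by a null sequence, changes the
    products by a convergent sequence. *)
Lemma cvg_inner_defect (e u a : nat -> H) l a' p q :
  e k @[k --> F] --> (0 : H) -> bweak F u l -> bweak F a a' ->
  inner (u k + e k - p) (a k - q) - inner (u k) (a k) @[k --> F] -->
  inner (l - p) (a' - q) - inner l a'.
Proof.
move=> e0 ul aa'.
have -> : (fun k => inner (u k + e k - p) (a k - q) - inner (u k) (a k)) =
    (fun k => inner (e k) (a k) - inner (a k) p - inner (u k + e k) q
              + inner p q).
  by apply/funext => k; rewrite !innerE [inner (a k) p]innerC; ring.
have -> : inner (l - p) (a' - q) - inner l a' =
    0 - inner a' p - inner l q + inner p q.
  by rewrite !innerE [inner a' p]innerC; ring.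
apply: cvgD; last exact: cvg_cst.
have [_ ue_cvg] := bweak_null_add e0 ul; have [_ a_cvg] := aa'.
apply: cvgB; last exact: ue_cvg.
by apply: cvgB; [exact: inner_null_bweak aa'|exact: a_cvg].
Qed.

End BoundedWeakConvergence.

Section Ultrafilters.
Variables (R : realType).

Lemma ultra_bounded_cvg (U : set_system nat) (f : nat -> R) (M : R) :
  UltraFilter U -> (\forall k \near U, `|f k| <= M) ->
  exists2 l, `|l| <= M & f k @[k --> U] --> l.
Proof.
move=> UU fM.
have := @segment_compact R (- M) M => /(_ (f @ U) _).
case=> [|l [lM cl]].
  by apply: filterS fM => k; rewrite /= in_itv /= ler_norml.
exists l; first by move: lM; rewrite /= in_itv /= ler_norml.
move=> V /= nV; have [//|UV] := in_ultra_setVsetC (f @^-1` V) UU.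
by have [x [/= nVx Vx]] := cl (~` V) V UV nV.
Qed.

(** The ultrafilter limits of the scalar products form a bounded linear
    functional, which the Riesz theorem represents by the weak limit. *)
Lemma ultra_bweak (H : hilbertType R) (U : set_system nat) (u : nat -> H) M :
  UltraFilter U -> (\forall k \near U, `|u k| <= M) -> exists l, bweak U u l.
Proof.
move=> UU uM.
have /choice[f fP] : forall w, exists l,
    `|l| <= M * `|w| /\ inner (u k) w @[k --> U] --> l.
  move=> w; have [|l lM ul] :=
      @ultra_bounded_cvg U (fun k => inner (u k) w) (M * `|w|).
    apply: filterS uM => k uk.
    by rewrite (le_trans (cauchy_schwarz_abs _ _)) // ler_wpM2r.
  by exists l.
have [x y|a x|x|l fl] := @riesz _ H f M.
- have : inner (u k) (x + y) @[k --> U] --> f x + f y.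
    under eq_fun do rewrite innerDr.
    by apply: cvgD; [exact: (fP x).2|exact: (fP y).2].
  exact: (cvg_unique _ (fP (x + y)).2).
- have : inner (u k) (a *: x) @[k --> U] --> a * f x.
    under eq_fun do rewrite innerZr.
    by apply: cvgM; [exact: cvg_cst|exact: (fP x).2].
  exact: (cvg_unique _ (fP (a *: x)).2).
- by have [] := fP x.
exists l; split=> [|w]; first by exists M.
by rewrite innerC -fl; exact: (fP w).2.
Qed.

(** If [l] were not a limit, an ultrafilter finer than [\oo] would contain the
    indices at which [f] stays out of some neighborhood of [l]. *)
Lemma cvg_ultra (V : topologicalType) (f : nat -> V) (l : V) :
  (forall U, UltraFilter U -> \oo `<=` U -> f k @[k --> U] --> l) ->
  f k @[k --> \oo] --> l.
Proof.
move=> h A nA; apply: contrapT => nfA.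
pose F := within (~` (f @^-1` A)) \oo.
have PF : ProperFilter F.
  apply: Build_ProperFilter => F0; apply: nfA; move: F0.
  by rewrite /F /within /=; apply: filterS => k /= fk; apply: contrapT => /fk.
have [U [UU FU]] := ultraFilterLemma PF.
have UnA : U (~` (f @^-1` A)) by apply: FU; exact: withinT.
have UA : U (f @^-1` A).
  apply: (h U UU _ A nA) => B oB; apply: FU; move: oB.
  by rewrite /F /within /=; apply: filterS => k Bk _.
by have [x []] := filter_ex (filterI UA UnA).
Qed.

Lemma eventually_ultra : exists U, UltraFilter U /\ \oo `<=` U.
Proof. exact: ultraFilterLemma. Qed.

End Ultrafilters.

(** * Nonincreasing summable sequences *)

Section SummableMonotone.
Variable R : realType.

(** The terms with index between [n / 2] and [n] are all at least [a n], and
    their sum is the difference of two partial sums far out. *)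
Lemma summable_nonincreasing_littleo (a : nat -> R) (M : R) :
  (forall k, 0 <= a k) -> (forall k, a k.+1 <= a k) ->
  (forall n, \sum_(k < n) a k <= M) ->
  n.+1%:R * a n @[n --> \oo] --> (0 : R).
Proof.
move=> a0 a_dec aM; pose S n := \sum_(k < n) a k.
have SS n : S n.+1 = S n + a n by rewrite /S big_ord_recr.
have a_le m n : (m <= n)%N -> a n <= a m.
  move=> /subnK <-; elim: (n - m)%N => // d IH.
  by rewrite addSn (le_trans (a_dec _)).
have Sc : cvgn S.
  apply: nondecreasing_is_cvgn.
    by apply/nondecreasing_seqP => n; rewrite SS lerDl.
  by exists M => _ [n _ <-]; exact: aM.
have S_gap m d : d.+1%:R * a (m + d)%N <= S (m + d).+1 - S m.
  elim: d => [|d IH]; first by rewrite addn0 mul1r SS addrC addKr.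
  rewrite addnS SS addrAC -natr1 mulrDl mul1r lerD //.
  by apply: le_trans IH; rewrite ler_wpM2l.
have half_oo : n./2 @[n --> \oo] --> \oo.
  move=> A [N _ NA]; exists N.*2 => // n /= Nn; apply: NA => /=.
  by rewrite -[N]doubleK half_leq.
have gap0 : 2 * (S n.+1 - S n./2) @[n --> \oo] --> (0 : R).
  have S1 : S n.+1 @[n --> \oo] --> limn S by rewrite (cvg_shiftS S).
  have := cvgM (cvg_cst (2 : R)) (cvgB S1 (cvg_comp _ _ half_oo Sc)).
  by rewrite subrr mulr0; apply.
apply: (@squeeze_cvgr _ _ _ _ (fun=> 0) (fun n => 2 * (S n.+1 - S n./2))).
- apply: nearW => n; rewrite mulr_ge0 //=.
  have hn : (n./2 <= n)%N.
    by rewrite leq_half_double ltnW // ltnS -addnn leq_addr.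
  have := S_gap n./2 (n - n./2)%N; rewrite subnKC // => h.
  apply: (@le_trans _ _ (2 * ((n - n./2).+1%:R * a n))); last first.
    by rewrite ler_pM2l.
  rewrite mulrA ler_wpM2r // -natrM ler_nat mul2n doubleS doubleB.
  rewrite ltnS (leq_trans _ (leqnSn _)) // leq_subRL ?leq_double //.
  by rewrite -[n.*2]addnn leq_add2r -{2}(odd_double_half n) leq_addl.
- exact: cvg_cst.
- exact: gap0.
Qed.

End SummableMonotone.

(** * Families of monotone operators, uniform monotonicity *)

Section MonotoneTerms.
Variable R : realType.

(** To bound one term of the sum from below, choose all the others
    nonpositive. *)
Lemma sum_terms_ge0 (I : finType) (S : I -> set R) (K : R) :
  (forall t, (forall i, S i (t i)) -> 0 <= \sum_i t i + K) -> K <= 0 ->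
  (forall i, exists2 s, S i s & s <= 0) ->
  forall i s, S i s -> 0 <= s.
Proof.
move=> S0 K0 Sneg i s Ss.
have /choice[t tP] : forall j, exists r, S j r /\ r <= 0.
  by move=> j; have [r Sr r0] := Sneg j; exists r.
have le0 : 0 <= \sum_j (if j == i then s else t j) + K.
  by apply: S0 => j; case: eqP => [->|_] //; exact: (tP j).1.
rewrite (bigD1 i) //= eqxx in le0.
have : \sum_(j | j != i) (if j == i then s else t j) <= 0.
  by apply: sumr_le0 => j /negPf ->; exact: (tP j).2.
lra.
Qed.

(** Either the point itself is in the graph, or maximality gives a point of the
    graph that is not monotonically related to it. *)
Lemma maximally_monotone_le0 (H : hilbertType R) (A : H -> set H) x u :
  maximally_monotone A -> exists p q, A p q /\ inner (x - p) (u - q) <= 0.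
Proof.
move=> /maximallyP[_ maxA].
have [Axu|nAxu] := pselect (A x u).
  by exists x, u; rewrite subrr inner0l.
apply: contrapT => nex; apply: nAxu; apply: maxA => p q Apq.
by rewrite leNgt; apply/negP => lt0; apply: nex; exists p, q; rewrite ltW.
Qed.

Variables (H : hilbertType R) (b : R) (C : H -> H).
Hypothesis b_gt0 : 0 < b.
Hypothesis hC : cocoercive b C.

Lemma cocoercive_lipschitz x y : `|C x - C y| <= b^-1 * `|x - y|.
Proof.
have [->|n0] := eqVneq (C x - C y) 0.
  by rewrite normr0 mulr_ge0 // invr_ge0 ltW.
have c0 : 0 < b * `|C x - C y| by rewrite mulr_gt0 ?normr_gt0.
rewrite -(ler_pM2l c0) -mulrA -expr2 (le_trans (hC x y)) //.
rewrite (le_trans (cauchy_schwarz _ _)) //.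
by rewrite [b * _]mulrC -mulrA mulVKf ?gt_eqF // mulrC.
Qed.

Lemma cocoercive_monotone x y : 0 <= inner (x - y) (C x - C y).
Proof. by apply: le_trans (hC x y); rewrite mulr_ge0 ?sqr_ge0 // ltW. Qed.

(** Maximality of a monotone Lipschitz map, tested at the points
    [x + t (c - C x)] with [t = b / 2], half the inverse of the Lipschitz
    constant. *)
Lemma cocoercive_maximal x c :
  (forall p, 0 <= inner (x - p) (c - C p)) -> c = C x.
Proof.
move=> rel; pose d := c - C x; pose p := x + (b / 2) *: d.
have le1 : inner d (c - C p) <= 0.
  have := rel p; rewrite /p opprD addNKr innerNl oppr_ge0 innerZl.
  by rewrite pmulr_rle0 // divr_gt0.
have le2 : inner d (C p - C x) <= 2^-1 * `|d| ^+ 2.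
  apply: (le_trans (cauchy_schwarz _ _)).
  apply: (@le_trans _ _ (`|d| * (b^-1 * `|p - x|))).
    by rewrite ler_wpM2l // cocoercive_lipschitz.
  have -> : p - x = (b / 2) *: d by rewrite /p addrC addKr.
  rewrite normrZ gtr0_norm ?divr_gt0 // le_eqVlt; apply/orP; left; apply/eqP.
  by field; rewrite gt_eqF.
have : inner d d = inner d (c - C p) + inner d (C p - C x).
  by rewrite -innerDr addrA subrK.
rewrite inner_norm => dE; have : `|d| ^+ 2 = 0.
  by apply/eqP; rewrite eq_le sqr_ge0 andbT; lra.
by move/eqP; rewrite sqrf_eq0 normr_eq0 subr_eq0 => /eqP.
Qed.

End MonotoneTerms.

Section UniformMonotonicity.
Variables (R : realType) (H : hilbertType R) (A : H -> set H).
Variables (F : set_system nat).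
Context {FF : ProperFilter F}.

(** If [u k] stays at distance at least [e] from [l], the product is at least
    [phi e], which is positive. *)
Lemma uniformly_monotone_cvg (u a : nat -> H) l a' :
  uniformly_monotone A -> (forall k, A (u k) (a k)) -> A l a' ->
  inner (u k - l) (a k - a') @[k --> F] --> (0 : R) -> u k @[k --> F] --> l.
Proof.
move=> [phi [phi_ge0 phi_le phi0 phi_mon]] Au Al prod0.
apply/cvgrPdistC_le => e e0.
have [c c0 c_phi] : exists2 c : R, 0 < c & (c%:E <= phi e)%E.
  have := phi_ge0 _ (ltW e0); have := phi0 _ (ltW e0).
  case: (phi e) => [r| |] //= phi_eq0; last by exists 1; rewrite ?leey.
  rewrite lee_fin le_eqVlt => /orP[/eqP r0|r0]; last by exists r.
  have e_eq0 := phi_eq0.1 (congr1 EFin (esym r0)).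
  by rewrite e_eq0 ltxx in e0.
apply: filterS (cvgr0_norm_lt _ prod0 _ c0) => k lt_c.
rewrite leNgt; apply/negP => lt_e.
have := le_trans c_phi (phi_le _ _ (ltW e0) (ltW lt_e)).
move=> /le_trans/(_ (phi_mon _ _ _ _ (Au k) Al)); rewrite lee_fin.
by move/(le_trans)/(_ (ler_norm _)); rewrite leNgt lt_c.
Qed.

End UniformMonotonicity.

(** * One step of the iteration as a system of inclusions *)

Section Splitting.
Variables (R : realType) (H G : hilbertType R) (m : nat).
Variables (A : 'I_m.+2 -> H -> set H) (B : G -> set G).
Variables (C : 'I_m.+1 -> H -> H) (L : {linear H -> G}).
Variables (alpha gamma : R).
Hypothesis hA : forall i, maximally_monotone (A i).
Hypothesis hB : maximally_monotone B.
Hypothesis hL : bounded_near L (nbhs (0 : H)).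
Hypothesis alpha_gt0 : 0 < alpha.
Hypothesis gamma_gt0 : 0 < gamma.
Implicit Types (z c : 'I_m.+1 -> H) (v y : G) (x p : 'I_m.+2 -> H).

Local Notation cur j := (widen_ord (leqnSn m.+1) j).
Local Notation nxt j := (lift (@ord0 m.+1) j).

Lemma unlift_cur (j : 'I_m.+1) : unlift ord_max (cur j) = Some j.
Proof.
have -> : cur j = lift ord_max j.
  by apply: val_inj; rewrite /= /bump leqNgt ltn_ord.
exact: liftK.
Qed.

Lemma cur_ord0 : cur ord0 = ord0. Proof. exact: val_inj. Qed.

Lemma nxt_max : nxt ord_max = ord_max. Proof. exact: val_inj. Qed.

(** The argument of the resolvent of [A i], with [c j] in place of
    [C j (x (cur j))], so that it is linear in all its data. In the two [unlift]
    tests, [Some j] means that [i] is [cur j], respectively [nxt j]. *)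
Definition resolvent_arg z v x c (i : 'I_m.+2) : H :=
  (if unlift ord_max i is Some j then z j
   else x ord0 - alpha *: adjoint L (gamma *: L (x ord0) - v)) -
  (if unlift ord0 i is Some j then z j - x (cur j) + alpha *: c j else 0).

Definition A_value z v x c (i : 'I_m.+2) : H :=
  alpha^-1 *: (resolvent_arg z v x c i - x i).

Definition B_value v x y : G :=
  gamma *: (L (x ord0) + L (x ord_max)) - v - gamma *: y.

Definition C_value x (j : 'I_m.+1) : H := C j (x (cur j)).

(** One step of the iteration, read as a system of inclusions. *)
Definition solves z v x y : Prop :=
  (forall i, A i (x i) (A_value z v x (C_value x) i)) /\ B y (B_value v x y).

Lemma xstep_J w i :
  xstep A C L alpha gamma w i =
  J alpha (A i) (resolvent_arg w.1 w.2 (xstep A C L alpha gamma w)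
                  (C_value (xstep A C L alpha gamma w)) i).
Proof.
rewrite /resolvent_arg /C_value; have [j ->|->] := unliftP ord0 i; last first.
  by rewrite -{3}cur_ord0 unlift_cur subr0.
rewrite {1}/xstep lift0 [xrec _ _ _ _ _ _ _ _]/=.
have [jm|jm] := eqVneq (j : nat) m.
  have -> : j = ord_max by exact: val_inj.
  rewrite nxt_max unlift_none inord_val /xstep /= opprD opprB.
  have shuffle (a b c d e : H) : a + b - c - d - e = a - d + (b - c - e).
    by rewrite !addrA [a - d + b]addrAC [a + b - d - c]addrAC.
  by rewrite shuffle.
have jm' : (j.+1 < m.+1)%N by rewrite ltnS ltn_neqAle jm -ltnS ltn_ord.
have -> : nxt j = cur (Ordinal jm') by exact: val_inj.
rewrite unlift_cur.
have -> : inord j.+1 = cur (Ordinal jm') :> 'I_m.+2.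
  by apply: val_inj; rewrite /= inordK // ltnW.
have -> : inord j.+1 = Ordinal jm' :> 'I_m.+1.
  by apply: val_inj; rewrite /= inordK.
rewrite inord_val /xstep /=; congr (J _ _ _).
by rewrite opprD opprB !addrA.
Qed.

Lemma step_solves w :
  solves w.1 w.2 (xstep A C L alpha gamma w) (ystep A B C L alpha gamma w).
Proof.
split=> [i|].
  rewrite /A_value {1 2}xstep_J; exact: J_resolvent.
have := J_resolvent (L (xstep A C L alpha gamma w ord0
  + xstep A C L alpha gamma w ord_max) - gamma^-1 *: w.2) _ hB.
move=> /(_ gamma^-1); rewrite invr_gt0 invrK => /(_ gamma_gt0).
rewrite -/(ystep A B C L alpha gamma w) /B_value.
by rewrite !scalerBr scalerA divff ?gt_eqF // scale1r linearD.
Qed.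

(** The argument of the resolvent of [A i] involves only components of [x] of
    index less than [i], so the system is triangular and has one solution. *)
Lemma solves_step z v x y : solves z v x y ->
  xstep A C L alpha gamma (z, v) = x /\ ystep A B C L alpha gamma (z, v) = y.
Proof.
move=> [sA sB].
have xJ i : x i = J alpha (A i) (resolvent_arg z v x (C_value x) i).
  by rewrite (@J_unique _ _ _ _ (x i)) //; have [] := hA i.
have ex : xstep A C L alpha gamma (z, v) = x.
  apply/funext => i; have [n] := ubnP (i : nat).
  elim: n => // n IH in i *; rewrite ltnS => le_in.
  rewrite xstep_J xJ; congr J; rewrite /resolvent_arg /=; congr (_ - _).
    have [j _|iM] := unliftP ord_max i; rewrite ?IH //.
    by apply: leq_trans le_in; rewrite iM.
  have [j iM|//] := unliftP ord0 i.
  by rewrite /C_value IH //; apply: leq_trans le_in; rewrite iM lift0.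
split=> //; rewrite /ystep ex (@J_unique _ _ _ _ y) ?invr_gt0 //.
  by have [] := hB.
have -> : L (x ord0 + x ord_max) = L (x ord0) + L (x ord_max) by exact: linearD.
by rewrite invrK !scalerBr scalerA divff ?gt_eqF // scale1r.
Qed.

(** Summation by parts: each [z j] enters the argument of [A (cur j)] and, with
    the opposite sign, that of [A (nxt j)]. *)
Lemma sum_A_value z v x c p :
  alpha * \sum_i inner (p i) (A_value z v x c i) =
  \sum_j (inner (p (cur j) - p (nxt j)) (z j - x (cur j))
          - alpha * inner (p (nxt j)) (c j))
  + inner (p ord_max) (x ord0 - x ord_max)
  - alpha * inner (L (p ord_max)) (gamma *: L (x ord0) - v).
Proof.
pose e i := if unlift ord_max i is Some j then z j
  else x ord0 - alpha *: adjoint L (gamma *: L (x ord0) - v).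
pose f i := if unlift ord0 i is Some j then z j - x (cur j) + alpha *: c j
  else 0.
have -> : alpha * \sum_i inner (p i) (A_value z v x c i) =
    \sum_i inner (p i) (e i) - \sum_i inner (p i) (f i)
    - \sum_i inner (p i) (x i).
  rewrite mulr_sumr -!sumrB; apply: eq_bigr => i _.
  by rewrite innerZr mulVKf ?gt_eqF // -!innerNr -!innerDr.
rewrite big_ord_recr /e unlift_none; under eq_bigr do rewrite unlift_cur.
rewrite [X in _ - X - _]big_ord_recl /f unlift_none inner0r add0r.
under [X in _ - X - _]eq_bigr do rewrite liftK.
rewrite [X in _ - _ - X]big_ord_recr /=.
have -> : \sum_j (inner (p (cur j) - p (nxt j)) (z j - x (cur j))
                  - alpha * inner (p (nxt j)) (c j)) =
    \sum_j inner (p (cur j)) (z j)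
    - \sum_j inner (p (nxt j)) (z j - x (cur j) + alpha *: c j)
    - \sum_j inner (p (cur j)) (x (cur j)).
  by rewrite -!sumrB; apply: eq_bigr => j _; rewrite !innerE; ring.
by rewrite [inner _ (_ - _ *: adjoint _ _)]innerDr [inner _ (x ord0 - _)]innerDr
           !innerNr innerZr adjointP //; ring.
Qed.

Lemma sum_A_value_sub z v x c z' v' x' c' p :
  alpha * \sum_i inner (p i) (A_value z v x c i - A_value z' v' x' c' i) =
  \sum_j (inner (p (cur j) - p (nxt j))
                (z j - z' j - (x (cur j) - x' (cur j)))
          - alpha * inner (p (nxt j)) (c j - c' j))
  + inner (p ord_max) (x ord0 - x' ord0 - (x ord_max - x' ord_max))
  - alpha * inner (L (p ord_max))
              (gamma *: (L (x ord0) - L (x' ord0)) - (v - v')).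
Proof.
under eq_bigr do rewrite innerDr innerNr.
rewrite sumrB mulrBr !sum_A_value.
have -> : \sum_j (inner (p (cur j) - p (nxt j))
                        (z j - z' j - (x (cur j) - x' (cur j)))
                  - alpha * inner (p (nxt j)) (c j - c' j)) =
    \sum_j (inner (p (cur j) - p (nxt j)) (z j - x (cur j))
          - alpha * inner (p (nxt j)) (c j)) -
    \sum_j (inner (p (cur j) - p (nxt j)) (z' j - x' (cur j))
          - alpha * inner (p (nxt j)) (c' j)).
  by rewrite -sumrB; apply: eq_bigr => j _; rewrite !innerE; ring.
by rewrite !innerE; ring.
Qed.

(** Against a common vector [q] the sum by parts has no jumps: up to the two
    terms on the right, the values of the operators satisfy the optimality
    condition of the primal problem. *)
Lemma inner_sum_values z v x c y q :
  \sum_i inner q (A_value z v x c i) + \sum_j inner q (c j)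
  + inner (L q) (B_value v x y) =
  alpha^-1 * inner q (x ord0 - x ord_max)
  + gamma * inner (L q) (L (x ord_max) - y).
Proof.
have an0 : alpha != 0 by rewrite gt_eqF.
apply: (mulfI an0).
rewrite mulrDr mulrDr (sum_A_value z v x c (fun=> q)).
under eq_bigr do rewrite subrr inner0l sub0r.
by rewrite sumrN -mulr_sumr /B_value !innerE; field.
Qed.

(** The sum by parts contains the cyclic products [<dx_i, dx_(i+1)>] and
    [<dx_n, dx_1>], whose completion to squares telescopes; the products
    [<L dx_1, L dx_n>], [<dy, L dx_1>] and [<dy, L dx_n>] are completed to
    squares as well. *)
Lemma total_identity z v x c y z' v' x' c' y' :
  let dz j := z j - z' j in let dx i := x i - x' i in
  let dc j := c j - c' j in let dy := y - y' in let dv := v - v' in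
  let s j := dx (cur j) - dx (nxt j) in
  let t := dy - L (dx ord_max) in
  alpha * (\sum_i inner (dx i) (A_value z v x c i - A_value z' v' x' c' i)
           + \sum_j inner (dx (cur j)) (dc j)
           + inner dy (B_value v x y - B_value v' x' y')) =
  \sum_j (inner (s j) (dz j) - 2^-1 * `|s j| ^+ 2 + alpha * inner (s j) (dc j))
  - alpha * inner dv t - 2^-1 * `|dx ord0 - dx ord_max| ^+ 2
  + 2^-1 * alpha * gamma * `|L (dx ord0 - dx ord_max)| ^+ 2
  - 2^-1 * alpha * gamma * `|t| ^+ 2
  - 2^-1 * alpha * gamma * `|dy - L (dx ord0)| ^+ 2.
Proof.
move=> dz dx dc dy dv s t; rewrite mulrDr mulrDr sum_A_value_sub.
have tele : \sum_j (`|dx (cur j)| ^+ 2 - `|dx (nxt j)| ^+ 2) =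
    `|dx ord0| ^+ 2 - `|dx ord_max| ^+ 2.
  have e : \sum_j `|dx (cur j)| ^+ 2 + `|dx ord_max| ^+ 2 =
      `|dx ord0| ^+ 2 + \sum_j `|dx (nxt j)| ^+ 2.
    transitivity (\sum_i `|dx i| ^+ 2); last exact: big_ord_recl.
    exact/esym/big_ord_recr.
  by rewrite sumrB (canRL (addrK _) e); ring.
have -> : \sum_j (inner (s j) (dz j) - 2^-1 * `|s j| ^+ 2
                  + alpha * inner (s j) (dc j)) =
    \sum_j (inner (dx (cur j) - dx (nxt j)) (dz j - dx (cur j))
             - alpha * inner (dx (nxt j)) (dc j))
    + alpha * \sum_j inner (dx (cur j)) (dc j)
    + 2^-1 * \sum_j (`|dx (cur j)| ^+ 2 - `|dx (nxt j)| ^+ 2).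
  rewrite !mulr_sumr -!big_split /=; apply: eq_bigr => j _.
  rewrite /s -!inner_norm; move: (dx (cur j)) (dx (nxt j)) => a b.
  by rewrite !innerE [inner b a]innerC; field.
rewrite tele /t /B_value -/dv -/(dx ord0) -/(dx ord_max).
have -> : L (dx ord0 - dx ord_max) = L (dx ord0) - L (dx ord_max).
  exact: linearB.
have -> : gamma *: (L (x ord0) + L (x ord_max)) - v - gamma *: y -
    (gamma *: (L (x' ord0) + L (x' ord_max)) - v' - gamma *: y') =
    gamma *: (L (dx ord0) + L (dx ord_max)) - dv - gamma *: dy.
  rewrite /dx !linearB /dv /dy; apply: inner_inj => w.
  by rewrite !innerE; ring.
have -> : L (x ord0) - L (x' ord0) = L (dx ord0) by rewrite /dx linearB.
rewrite -!inner_norm {t tele}.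
move: (dx ord0) (dx ord_max) dv dy => a b d e.
rewrite !innerE [inner b a]innerC [inner (L b) (L a)]innerC.
rewrite [inner (L a) e]innerC [inner (L b) e]innerC [inner (L b) d]innerC.
rewrite [inner e d]innerC.
by field.
Qed.

(** * The step is averaged *)

Definition jump x (j : 'I_m.+1) : H := x (cur j) - x (nxt j).
Definition gap x y : G := y - L (x ord_max).

Section Fejer.
Variables (b : 'I_m.+1 -> R) (beta lambda : R).
Hypothesis b_gt0 : forall j, 0 < b j.
Hypothesis b_le : forall j, b j <= beta.
Hypothesis hC : forall j, cocoercive (b j)^-1 (C j).
Hypothesis gammaL : alpha * gamma * opnorm L ^+ 2 <= 1.

(** Monotonicity makes the left side of [total_identity] at least the sum of the
    cocoercivity terms, which pay for the products [<ds_j, dc_j>] by Young's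
    inequality. *)
Lemma sum_steps_le z v x y z' v' x' y' :
  solves z v x y -> solves z' v' x' y' ->
  (1 - alpha * beta / 2) / 2
    * (\sum_j `|jump x j - jump x' j| ^+ 2
       + alpha * gamma * `|gap x y - gap x' y'| ^+ 2) <=
  \sum_j inner (jump x j - jump x' j) (z j - z' j)
  - alpha * inner (v - v') (gap x y - gap x' y').
Proof.
move=> [sA sB] [sA' sB'].
pose dx i := x i - x' i; pose dc j := C_value x j - C_value x' j.
pose s j := jump x j - jump x' j; pose t := gap x y - gap x' y'.
have sE j : s j = dx (cur j) - dx (nxt j).
  by rewrite /s /jump /dx !opprD addrACA.
have tE : t = y - y' - L (dx ord_max).
  by rewrite (linearB L) /t /gap !opprD addrACA.
pose total := \sum_i inner (dx i) (A_value z v x (C_value x) i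
                                  - A_value z' v' x' (C_value x') i)
  + \sum_j inner (dx (cur j)) (dc j)
  + inner (y - y') (B_value v x y - B_value v' x' y').
have total_eq : alpha * total =
    \sum_j (inner (s j) (z j - z' j) - 2^-1 * `|s j| ^+ 2
            + alpha * inner (s j) (dc j))
    - alpha * inner (v - v') t - 2^-1 * `|dx ord0 - dx ord_max| ^+ 2
    + 2^-1 * alpha * gamma * `|L (dx ord0 - dx ord_max)| ^+ 2
    - 2^-1 * alpha * gamma * `|t| ^+ 2
    - 2^-1 * alpha * gamma * `|y - y' - L (dx ord0)| ^+ 2.
  by under eq_bigr do rewrite sE; rewrite tE; exact: total_identity.
rewrite -/t; under eq_bigr do rewrite -/(s _).
under [X in _ <= X - _]eq_bigr do rewrite -/(s _).
have ag : 0 < alpha * gamma by rewrite mulr_gt0.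
have mono : alpha * \sum_j (b j)^-1 * `|dc j| ^+ 2 <= alpha * total.
  rewrite ler_pM2l // /total -addrA [leRHS]addrCA ler_wpDr //.
    apply: addr_ge0; first by apply: sumr_ge0 => i _; apply: (hA i).1.
    exact: hB.1.
  by apply: ler_sum => j _; exact: hC.
have young j : inner (s j) (z j - z' j) - 2^-1 * `|s j| ^+ 2
      + alpha * inner (s j) (dc j) <=
    inner (s j) (z j - z' j) - (2^-1 - alpha * beta / 4) * `|s j| ^+ 2
      + alpha * ((b j)^-1 * `|dc j| ^+ 2).
  have bj := b_gt0 j.
  have h := inner_young (s j) (dc j) bj.
  have h2 : b j / 4 * `|s j| ^+ 2 <= beta / 4 * `|s j| ^+ 2.
    by rewrite ler_wpM2r ?sqr_ge0 // ler_pM2r ?invr_gt0.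
  have : alpha * inner (s j) (dc j) <=
      alpha * ((b j)^-1 * `|dc j| ^+ 2 + beta / 4 * `|s j| ^+ 2).
    by rewrite ler_pM2l //; lra.
  lra.
have := @ler_sum _ _ (index_enum 'I_m.+1) xpredT _ _ (fun j _ => young j).
rewrite [leRHS]big_split /= sumrB -!mulr_sumr => sum_young.
have Lle : alpha * gamma * `|L (dx ord0 - dx ord_max)| ^+ 2 <=
    `|dx ord0 - dx ord_max| ^+ 2.
  have := opnormP hL (dx ord0 - dx ord_max).
  rewrite -(@ler_pXn2r _ 2) ?nnegrE ?mulr_ge0 ?opnorm_ge0 // exprMn => h.
  apply: (@le_trans _ _ (alpha * gamma * opnorm L ^+ 2
                         * `|dx ord0 - dx ord_max| ^+ 2)).
    by rewrite -[leRHS]mulrA ler_pM2l.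
  by rewrite ler_piMl // sqr_ge0.
have ab0 : 0 <= alpha * beta.
  by rewrite mulr_ge0 ?(ltW alpha_gt0) // (le_trans (ltW (b_gt0 ord0))).
have t0 : 0 <= alpha * beta * (alpha * gamma * `|t| ^+ 2).
  by apply: mulr_ge0 ab0 _; rewrite !mulr_ge0 ?sqr_ge0 // ltW.
have y0 : 0 <= alpha * gamma * `|y - y' - L (dx ord0)| ^+ 2.
  by rewrite !mulr_ge0 ?sqr_ge0 // ltW.
lra.
Qed.

(** The square of the weighted norm with weight [alpha / gamma]. *)
Definition sqdist z v := \sum_j `|z j| ^+ 2 + alpha / gamma * `|v| ^+ 2.
Definition defect x y :=
  \sum_j `|jump x j| ^+ 2 + alpha * gamma * `|gap x y| ^+ 2.

Lemma sqdist_ge0 z v : 0 <= sqdist z v.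
Proof.
apply: addr_ge0; first by apply: sumr_ge0 => j _; exact: sqr_ge0.
by rewrite mulr_ge0 ?sqr_ge0 // divr_ge0 // ltW.
Qed.

Lemma defect_ge0 x y : 0 <= defect x y.
Proof.
apply: addr_ge0; first by apply: sumr_ge0 => j _; exact: sqr_ge0.
by rewrite mulr_ge0 ?sqr_ge0 // mulr_ge0 // ltW.
Qed.

Hypothesis lambda_gt0 : 0 < lambda.

Let x_ w := xstep A C L alpha gamma w.
Let y_ w := ystep A B C L alpha gamma w.
Let T_ w := T A B C L alpha gamma lambda w.

Lemma T1E w j : (T_ w).1 j = w.1 j - lambda *: jump (x_ w) j.
Proof. by rewrite /T_ /T /= /jump -scalerN opprB. Qed.

Lemma T2E w : (T_ w).2 = w.2 + (lambda * gamma) *: gap (x_ w) (y_ w).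
Proof. by []. Qed.

(** The step moves [w] by [lambda] times its jumps and its gap, so the subtracted
    term is a multiple of the squared weighted distance between [w - T w] and
    [w' - T w']. *)
Lemma T_sqdist w w' :
  sqdist (fun j => (T_ w).1 j - (T_ w').1 j) ((T_ w).2 - (T_ w').2) <=
  sqdist (fun j => w.1 j - w'.1 j) (w.2 - w'.2)
  - lambda * (1 - alpha * beta / 2 - lambda)
    * (\sum_j `|jump (x_ w) j - jump (x_ w') j| ^+ 2
       + alpha * gamma * `|gap (x_ w) (y_ w) - gap (x_ w') (y_ w')| ^+ 2).
Proof.
have := sum_steps_le (step_solves w) (step_solves w').
rewrite -/(x_ w) -/(x_ w') -/(y_ w) -/(y_ w').
set t := gap _ _ - gap _ _ => le_steps.
have gn : gamma != 0 by rewrite gt_eqF.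
have -> : sqdist (fun j => (T_ w).1 j - (T_ w').1 j) ((T_ w).2 - (T_ w').2) =
    sqdist (fun j => w.1 j - w'.1 j) (w.2 - w'.2)
    - 2 * lambda
      * (\sum_j inner (jump (x_ w) j - jump (x_ w') j) (w.1 j - w'.1 j)
                    - alpha * inner (w.2 - w'.2) t)
    + lambda ^+ 2 * (\sum_j `|jump (x_ w) j - jump (x_ w') j| ^+ 2
                     + alpha * gamma * `|t| ^+ 2).
  rewrite /sqdist.
  have -> : \sum_j `|(T_ w).1 j - (T_ w').1 j| ^+ 2 =
      \sum_j `|w.1 j - w'.1 j| ^+ 2
      - 2 * lambda
        * \sum_j inner (jump (x_ w) j - jump (x_ w') j) (w.1 j - w'.1 j)
      + lambda ^+ 2 * \sum_j `|jump (x_ w) j - jump (x_ w') j| ^+ 2.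
    rewrite !mulr_sumr -sumrB -big_split /=; apply: eq_bigr => j _.
    have -> : (T_ w).1 j - (T_ w').1 j =
        w.1 j - w'.1 j - lambda *: (jump (x_ w) j - jump (x_ w') j).
      rewrite !T1E; move: (jump _ _) (jump (x_ w') _) => s s'.
      by rewrite scalerBr !opprD addrACA.
    move: (w.1 j - w'.1 j) (jump _ _ - jump _ _) => d s.
    by rewrite -!inner_norm !innerE [inner d s]innerC; ring.
  have -> : (T_ w).2 - (T_ w').2 = w.2 - w'.2 + (lambda * gamma) *: t.
    rewrite !T2E /t; move: (gap _ _) (gap (x_ w') _) => s s'.
    by rewrite scalerBr opprD addrACA.
  clear le_steps; move: (w.2 - w'.2) t => d s.
  by rewrite -!inner_norm !innerE [inner s d]innerC; field.
have : 2 * lambda * ((1 - alpha * beta / 2) / 2 *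
      (\sum_j `|jump (x_ w) j - jump (x_ w') j| ^+ 2
       + alpha * gamma * `|t| ^+ 2)) <=
    2 * lambda * (\sum_j inner (jump (x_ w) j - jump (x_ w') j) (w.1 j - w'.1 j)
                  - alpha * inner (w.2 - w'.2) t).
  by rewrite ler_pM2l // mulr_gt0.
by move: (\sum_j `|jump _ _ - _| ^+ 2 + _) (\sum_j inner _ _ - _) => D I; lra.
Qed.

Lemma T_nonexpansive w w' : lambda <= 1 - alpha * beta / 2 ->
  sqdist (fun j => (T_ w).1 j - (T_ w').1 j) ((T_ w).2 - (T_ w').2) <=
  sqdist (fun j => w.1 j - w'.1 j) (w.2 - w'.2).
Proof.
move=> lk; apply: le_trans (T_sqdist w w') _; rewrite gerBl mulr_ge0 //.
  by rewrite mulr_ge0 ?subr_ge0 // ltW.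
apply: addr_ge0; first by apply: sumr_ge0 => j _; exact: sqr_ge0.
by rewrite !mulr_ge0 ?sqr_ge0 // ltW.
Qed.

Lemma T_residual w :
  sqdist (fun j => w.1 j - (T_ w).1 j) (w.2 - (T_ w).2)
  = lambda ^+ 2 * defect (x_ w) (y_ w).
Proof.
have gn : gamma != 0 by rewrite gt_eqF.
rewrite /sqdist /defect mulrDr mulr_sumr; congr (_ + _).
  apply: eq_bigr => j _; rewrite T1E opprB addrC subrK -!inner_norm !innerE.
  by ring.
by rewrite T2E opprD addNKr normrN -!inner_norm !innerE; field.
Qed.

Lemma solves_fixed z v q : solves z v (fun=> q) (L q) ->
  [/\ T_ (z, v) = (z, v), x_ (z, v) = (fun=> q) & y_ (z, v) = L q].
Proof.
move=> sol; have [ex ey] := solves_step sol; split=> //.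
rewrite [T_ _]surjective_pairing; congr pair.
  by apply/funext => j; rewrite T1E /x_ ex /jump subrr scaler0 subr0.
by rewrite T2E /x_ /y_ ex ey /gap subrr scaler0 addr0.
Qed.

Lemma T_fejer w z v q : solves z v (fun=> q) (L q) ->
  sqdist (fun j => (T_ w).1 j - z j) ((T_ w).2 - v) <=
  sqdist (fun j => w.1 j - z j) (w.2 - v)
  - lambda * (1 - alpha * beta / 2 - lambda) * defect (x_ w) (y_ w).
Proof.
move=> sol; have [eT ex ey] := solves_fixed sol.
have := T_sqdist w (z, v); rewrite eT ex ey /jump /gap !subrr.
by under eq_bigr do rewrite subr0; rewrite subr0.
Qed.

End Fejer.

(** * Weak cluster points of solutions with vanishing defects *)

Section Cluster.
Variable b : 'I_m.+1 -> R.
Hypothesis b_gt0 : forall j, 0 < b j.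
Hypothesis hC : forall j, cocoercive (b j)^-1 (C j).
Variables (U : set_system nat) (zs : nat -> 'I_m.+1 -> H) (vs : nat -> G).
Variables (xs : nat -> 'I_m.+2 -> H) (ys : nat -> G).
Context {PU : ProperFilter U}.
Hypothesis sol : forall k, solves (zs k) (vs k) (xs k) (ys k).
Hypothesis jump0 : forall j, jump (xs k) j @[k --> U] --> (0 : H).
Hypothesis gap0 : gap (xs k) (ys k) @[k --> U] --> (0 : G).

Lemma x_diff0 i : xs k i - xs k ord0 @[k --> U] --> (0 : H).
Proof.
have [n] := ubnP (i : nat); elim: n => // n IH in i *; rewrite ltnS => le_in.
have [j iE|->] := unliftP ord0 i; last first.
  by under eq_fun do rewrite subrr; exact: cvg_cst.
have -> : (fun k => xs k i - xs k ord0) =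
    (fun k => xs k (cur j) - xs k ord0 - jump (xs k) j).
  by apply/funext => k; rewrite iE /jump opprB [in RHS]addrC addrA subrK.
rewrite -(subr0 (0 : H)); apply: cvgB; last exact: jump0.
by apply: IH; apply: leq_trans le_in; rewrite iE lift0.
Qed.

Lemma y_diff0 : ys k - L (xs k ord0) @[k --> U] --> (0 : G).
Proof.
have [M M0 LM] := bounded_linear_bound hL.
have L0 : L (xs k ord_max - xs k ord0) @[k --> U] --> (0 : G).
  apply: (@cvg_lipschitz _ _ _ _ _ _ _ _ _ _ M _ (x_diff0 ord_max)) => k.
  by rewrite !subr0.
have -> : (fun k => ys k - L (xs k ord0)) =
    (fun k => gap (xs k) (ys k) + L (xs k ord_max - xs k ord0)).
  by apply/funext => k; rewrite (linearB L) /gap addrA subrK.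
by rewrite -(addr0 (0 : G)); exact: cvgD.
Qed.

Variables (zb : 'I_m.+1 -> H) (vb : G) (xb : H) (cb : 'I_m.+1 -> H).
Hypothesis z_lim : forall j, bweak U (fun k => zs k j) (zb j).
Hypothesis v_lim : bweak U vs vb.
Hypothesis x0_lim : bweak U (fun k => xs k ord0) xb.
Hypothesis c_lim : forall j, bweak U (fun k => C_value (xs k) j) (cb j).

Lemma x_lim i : bweak U (fun k => xs k i) xb.
Proof.
have -> : (fun k => xs k i) = (fun k => xs k ord0 + (xs k i - xs k ord0)).
  by apply/funext => k; rewrite addrC subrK.
exact: bweak_null_add (x_diff0 i) x0_lim.
Qed.

Lemma bweakL (u : nat -> H) l : bweak U u l -> bweak U (fun k => L (u k)) (L l).
Proof.
have [M _ LM] := bounded_linear_bound hL.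
by apply: (bweak_adjointable (f' := adjoint L)) LM => x z; rewrite adjointP.
Qed.

Lemma bweak_adjoint (u : nat -> G) l :
  bweak U u l -> bweak U (fun k => adjoint L (u k)) (adjoint L l).
Proof.
have [M _ LM] := adjoint_bound hL.
apply: (bweak_adjointable (f' := L)) LM => x z.
by rewrite innerC adjointP // innerC.
Qed.

Lemma y_lim : bweak U ys (L xb).
Proof.
have -> : ys = (fun k => L (xs k ord0) + (ys k - L (xs k ord0))).
  by apply/funext => k; rewrite addrC subrK.
by apply: bweak_null_add y_diff0 _; exact: bweakL.
Qed.

Local Notation ab := (A_value zb vb (fun=> xb) cb).
Local Notation bb := (B_value vb (fun=> xb) (L xb)).
Local Notation a_ k := (A_value (zs k) (vs k) (xs k) (C_value (xs k))).
Local Notation b_ k := (B_value (vs k) (xs k) (ys k)).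

Lemma A_value_lim i : bweak U (fun k => a_ k i) (ab i).
Proof.
apply: bweakZ; apply: bweakB (x_lim i); rewrite /resolvent_arg.
apply: bweakB.
  case: (unlift ord_max i) => [j|]; first exact: z_lim.
  apply: bweakB => //; apply: bweakZ; apply: bweak_adjoint; apply: bweakB => //.
  by apply: bweakZ; exact: bweakL.
case: (unlift ord0 i) => [j|]; last exact: bweak_cst.
apply: bweakD; last by apply: bweakZ; exact: c_lim.
by apply: bweakB; [exact: z_lim|exact: x_lim].
Qed.

Lemma B_value_lim : bweak U (fun k => b_ k) bb.
Proof.
apply: bweakB; last by apply: bweakZ; exact: y_lim.
apply: bweakB => //; apply: bweakZ.
by apply: bweakD; apply: bweakL; exact: x_lim.
Qed.

(** Replacing every component of [xs k] by [xs k ord0], and [ys k] by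
    [L (xs k ord0)], changes the products by null sequences only; and after this
    replacement the products of two weakly convergent factors add up, by
    [inner_sum_values], to products with the null sequences. *)
Lemma total_cvg (p q : 'I_m.+2 -> H) (p' q' : 'I_m.+1 -> H) (r s : G) :
  \sum_i inner (xs k i - p i) (a_ k i - q i)
  + \sum_j inner (xs k (cur j) - p' j) (C_value (xs k) j - q' j)
  + inner (ys k - r) (b_ k - s) @[k --> U] -->
  \sum_i inner (xb - p i) (ab i - q i) + \sum_j inner (xb - p' j) (cb j - q' j)
  + inner (L xb - r) (bb - s).
Proof.
pose K k := \sum_i inner (xs k ord0) (a_ k i)
  + \sum_j inner (xs k ord0) (C_value (xs k) j) + inner (L (xs k ord0)) (b_ k).
have K0 : K k @[k --> U] --> (0 : R).
  have -> : K = fun k =>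
      - (alpha^-1 * inner (xs k ord_max - xs k ord0) (xs k ord0))
      - gamma * inner (gap (xs k) (ys k)) (L (xs k ord0)).
    apply/funext => k; rewrite /K inner_sum_values.
    rewrite [inner _ (xs k ord0)]innerC [inner (gap _ _) _]innerC /gap.
    by rewrite !innerE; ring.
  have L0 := bweakL x0_lim.
  have e1 := [elaborate inner_null_bweak (x_diff0 ord_max) x0_lim].
  have e2 := [elaborate inner_null_bweak gap0 L0].
  have := [elaborate cvgB (cvgN (cvgM (cvg_cst alpha^-1) e1))
                        (cvgM (cvg_cst gamma) e2)].
  by rewrite !mulr0 oppr0 addr0; apply.
have Kb : \sum_i inner xb (ab i) + \sum_j inner xb (cb j) + inner (L xb) bb = 0.
  by rewrite inner_sum_values !subrr !inner0r !mulr0 addr0.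
have cA i : inner (xs k i - p i) (a_ k i - q i) - inner (xs k ord0) (a_ k i)
    @[k --> U] --> inner (xb - p i) (ab i - q i) - inner xb (ab i).
  have -> : (fun k => inner (xs k i - p i) (a_ k i - q i)
                      - inner (xs k ord0) (a_ k i)) =
      (fun k => inner (xs k ord0 + (xs k i - xs k ord0) - p i) (a_ k i - q i)
                - inner (xs k ord0) (a_ k i)).
    by apply/funext => k; rewrite [xs k ord0 + _]addrC subrK.
  exact: cvg_inner_defect (x_diff0 i) x0_lim (A_value_lim i).
have cC j : inner (xs k (cur j) - p' j) (C_value (xs k) j - q' j)
      - inner (xs k ord0) (C_value (xs k) j)
    @[k --> U] --> inner (xb - p' j) (cb j - q' j) - inner xb (cb j).
  have -> : (fun k => inner (xs k (cur j) - p' j) (C_value (xs k) j - q' j)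
                      - inner (xs k ord0) (C_value (xs k) j)) =
      (fun k => inner (xs k ord0 + (xs k (cur j) - xs k ord0) - p' j)
                  (C_value (xs k) j - q' j)
                - inner (xs k ord0) (C_value (xs k) j)).
    by apply/funext => k; rewrite [xs k ord0 + _]addrC subrK.
  exact: cvg_inner_defect (x_diff0 _) x0_lim (c_lim j).
have cB : inner (ys k - r) (b_ k - s) - inner (L (xs k ord0)) (b_ k)
    @[k --> U] --> inner (L xb - r) (bb - s) - inner (L xb) bb.
  have -> : (fun k => inner (ys k - r) (b_ k - s)
                      - inner (L (xs k ord0)) (b_ k)) =
      (fun k => inner (L (xs k ord0) + (ys k - L (xs k ord0)) - r) (b_ k - s)
                - inner (L (xs k ord0)) (b_ k)).
    by apply/funext => k; rewrite [L (xs k ord0) + _]addrC subrK.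
  exact: cvg_inner_defect y_diff0 (bweakL x0_lim) B_value_lim.
set F := (fun k => \sum_i _ + _ + _); set l := (X in _ --> X).
have -> : F = fun k =>
    \sum_i (inner (xs k i - p i) (a_ k i - q i) - inner (xs k ord0) (a_ k i))
    + \sum_j (inner (xs k (cur j) - p' j) (C_value (xs k) j - q' j)
              - inner (xs k ord0) (C_value (xs k) j))
    + (inner (ys k - r) (b_ k - s) - inner (L (xs k ord0)) (b_ k)) + K k.
  by apply/funext => k; rewrite /F /K !sumrB; ring.
have -> : l = \sum_i (inner (xb - p i) (ab i - q i) - inner xb (ab i))
    + \sum_j (inner (xb - p' j) (cb j - q' j) - inner xb (cb j))
    + (inner (L xb - r) (bb - s) - inner (L xb) bb) + 0.
  by rewrite !sumrB addr0 -[LHS]subr0 -[X in _ - X = _]Kb /l; ring.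
exact: cvgD (cvgD (cvgD (cvg_sumr cA) (cvg_sumr cC)) cB) K0.
Qed.

(** By [total_cvg] the limit of the sum of all the monotonicity products is
    nonnegative, whatever point of each graph is tested; hence so is each
    single product, and maximality applies. *)
Lemma cluster_inclusions :
  [/\ forall i, A i xb (ab i), forall j, cb j = C j xb & B (L xb) bb].
Proof.
have total_ge0 (p q : 'I_m.+2 -> H) (p' : 'I_m.+1 -> H) (r s : G) :
    (forall i, A i (p i) (q i)) -> B r s ->
    0 <= \sum_i inner (xb - p i) (ab i - q i)
         + \sum_j inner (xb - p' j) (cb j - C j (p' j))
         + inner (L xb - r) (bb - s).
  move=> Apq Brs.
  have lim := @total_cvg p q p' (fun j => C j (p' j)) r s.
  apply: (cvgr_to_ge lim).
  apply: nearW => k; have [sA sB] := sol k.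
  apply: addr_ge0; last exact: hB.1.
  apply: addr_ge0; apply: sumr_ge0 => i _; first exact: (hA i).1.
  have bi : 0 < (b i)^-1 by rewrite invr_gt0.
  exact: (cocoercive_monotone bi (hC i)).
have /choice[pq pqP] : forall i, exists pq : H * H,
    A i pq.1 pq.2 /\ inner (xb - pq.1) (ab i - pq.2) <= 0.
  move=> i; have [p [q [Apq le0]]] := maximally_monotone_le0 xb (ab i) (hA i).
  by exists (p, q).
have [r [s [Brs rs0]]] := maximally_monotone_le0 (L xb) bb hB.
have sumA0 : \sum_i inner (xb - (pq i).1) (ab i - (pq i).2) <= 0.
  by apply: sumr_le0 => i _; exact: (pqP i).2.
split=> [i|j|].
- have /maximallyP[_ maxA] := hA i; apply: maxA => p q Apq.
  pose S i := [set inner (xb - w.1) (ab i - w.2)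
              | w in [set w : H * H | A i w.1 w.2]].
  apply: (@sum_terms_ge0 R _ S (inner (L xb - r) (bb - s)) _ _ _ i) => //.
  + move=> t St; have /choice[w wP] : forall i, exists w : H * H,
        A i w.1 w.2 /\ inner (xb - w.1) (ab i - w.2) = t i.
      by move=> i'; have [w Aw <-] := St i'; exists w.
    have := total_ge0 (fun i => (w i).1) (fun i => (w i).2) (fun=> xb) r s.
    move=> /(_ (fun i => (wP i).1) Brs).
    under eq_bigr do rewrite (wP _).2.
    rewrite [X in _ + X + _]big1 ?addr0 // => j _.
    by rewrite subrr inner0l.
  + move=> i'; exists (inner (xb - (pq i').1) (ab i' - (pq i').2)).
      by exists (pq i') => //; exact: (pqP i').1.
    exact: (pqP i').2.
  + by exists (p, q).
- have bj : 0 < (b j)^-1 by rewrite invr_gt0.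
  apply: (cocoercive_maximal bj (hC j)) => p.
  pose S j := [set inner (xb - w) (cb j - C j w) | w in [set: H]].
  apply: (@sum_terms_ge0 R _ S (\sum_i inner (xb - (pq i).1) (ab i - (pq i).2)
                                + inner (L xb - r) (bb - s)) _ _ _ j).
  + move=> t St; have /choice[w wP] : forall j, exists w,
        inner (xb - w) (cb j - C j w) = t j.
      by move=> j'; have [w _ <-] := St j'; exists w.
    have := total_ge0 (fun i => (pq i).1) (fun i => (pq i).2) w r s.
    move=> /(_ (fun i => (pqP i).1) Brs).
    by under [X in _ + X + _]eq_bigr do rewrite wP; rewrite -addrA addrCA.
  + by lra.
  + by move=> j'; exists 0 => //; exists xb => //; rewrite subrr inner0l.
  + by exists p.
- have /maximallyP[_ maxB] := hB; apply: maxB => r' s' Brs'.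
  have := total_ge0 (fun i => (pq i).1) (fun i => (pq i).2) (fun=> xb) r' s'.
  move=> /(_ (fun i => (pqP i).1) Brs').
  rewrite [X in _ + X + _]big1 ?addr0; first by lra.
  by move=> j _; rewrite subrr inner0l.
Qed.

Lemma cluster_solves : solves zb vb (fun=> xb) (L xb).
Proof.
have [sA sC sB] := cluster_inclusions; split=> // i.
have -> : C_value (fun=> xb) = cb by apply/funext => j; rewrite sC.
exact: sA.
Qed.

(** The sum of the products between the iterates and their limits tends to [0],
    and its terms are nonnegative. *)
Lemma cluster_product i :
  inner (xs k i - xb) (a_ k i - ab i) @[k --> U] --> (0 : R).
Proof.
have [sA sC sB] := cluster_inclusions.
have := @total_cvg (fun=> xb) ab (fun=> xb) (fun j => C j xb) (L xb) bb.
under eq_bigr do rewrite subrr inner0l.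
under [X in _ --> _ + X + _]eq_bigr do rewrite subrr inner0l.
rewrite !big1 // subrr inner0l !addr0 => tot.
apply: (squeeze_cvgr _ (cvg_cst 0) tot).
apply: nearW => k; have [solA solB] := sol k.
have term_ge0 i' : 0 <= inner (xs k i' - xb) (a_ k i' - ab i').
  by apply: (hA i').1.
rewrite term_ge0 /= -addrA (bigD1 i) //= -addrA lerDl.
apply: addr_ge0; first by apply: sumr_ge0.
apply: addr_ge0; last exact: hB.1.
apply: sumr_ge0 => j _; have bj : 0 < (b j)^-1 by rewrite invr_gt0.
exact: (cocoercive_monotone bj (hC j)).
Qed.

End Cluster.

(** * Fixed points and solutions of the primal and dual problems *)

Lemma big_set_addP n (F : 'I_n -> set H) s :
  (\big[@set_add R H/[set 0]]_i F i) s <->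
  exists a : 'I_n -> H, (forall i, F i (a i)) /\ s = \sum_i a i.
Proof.
elim: n => [|n IH] in F s *.
  rewrite big_ord0; split=> [->|[a [_ ->]]]; last by rewrite big_ord0.
  by exists (fun=> 0); split; [case|rewrite big_ord0].
rewrite big_ord_recl; split.
  move=> [a0 Fa0 [s' /IH[a [Fa ->]] <-]].
  exists (fun i => if unlift ord0 i is Some j then a j else a0); split.
    by move=> i; have [j ->|->] := unliftP ord0 i.
  by rewrite big_ord_recl unlift_none; under [in RHS]eq_bigr do rewrite liftK.
move=> [a [Fa ->]]; exists (a ord0) => //.
exists (\sum_i a (lift ord0 i)); last by rewrite big_ord_recl.
by apply/IH; exists (fun i => a (lift ord0 i)).
Qed.

Lemma solves_values z v q : solves z v (fun=> q) (L q) ->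
  exists a : 'I_m.+2 -> H, [/\ forall i, A i q (a i),
    B (L q) (gamma *: L q - v) &
    \sum_i a i + adjoint L (gamma *: L q - v) + \sum_j C j q = 0].
Proof.
move=> [sA sB]; exists (A_value z v (fun=> q) (C_value (fun=> q))).
have bE : B_value v (fun=> q) (L q) = gamma *: L q - v.
  by rewrite /B_value scalerDr addrAC addrK.
split=> //; first by rewrite -bE.
apply: inner_inj => w; rewrite inner0l innerC.
have := inner_sum_values z v (fun=> q) (C_value (fun=> q)) (L q) w.
rewrite !subrr !inner0r !mulr0 addr0 bE => e.
rewrite -[RHS]e; move: (gamma *: L q - v) => u.
by rewrite !innerDr !inner_sumr adjointP // addrAC.
Qed.

Lemma solves_primal z v q : solves z v (fun=> q) (L q) -> primal A B C L q.
Proof.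
move=> /solves_values[a [Aa Bb sum0]]; rewrite /primal /=.
exists (\sum_i a i + adjoint L (gamma *: L q - v)); last first.
  by exists (\sum_j C j q).
exists (\sum_i a i); first by apply/big_set_addP; exists a.
by exists (adjoint L (gamma *: L q - v)).
Qed.

Lemma solves_dual z v q : solves z v (fun=> q) (L q) ->
  dual A B C L (gamma *: L q - v).
Proof.
move=> /solves_values[a [Aa Bb sum0]]; rewrite /dual /=.
exists (- L q); last by exists (L q) => //; rewrite addNr.
exists q => //; rewrite /op_inv /= /sumAC.
exists (\sum_i a i); first by apply/big_set_addP; exists a.
exists (\sum_j C j q) => //; apply/eqP; rewrite -addr_eq0 addrAC.
exact/eqP.
Qed.

(** The first [m.+1] inclusions determine [z] by partial sums, and the last one
    is the optimality condition. *)
Lemma primal_solves q : primal A B C L q ->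
  exists z v, solves z v (fun=> q) (L q).
Proof.
move=> [_ [_ /big_set_addP[a [Aa ->]] [_ [u Bu <-] <-]] [_ -> sum0]].
pose Z (j : nat) := q + alpha *: (\sum_(0 <= l < j.+1) a (inord l)
                                 + \sum_(0 <= l < j) C (inord l) q).
have ZS (j : nat) : Z j.+1 = Z j + alpha *: (a (inord j.+1) + C (inord j) q).
  rewrite /Z (big_nat_recr j.+1) //.
  rewrite (big_nat_recr j 0 (fun l => C (inord l) q)) //=.
  by rewrite addrACA scalerDr addrA.
have Z0 : Z 0%N = q + alpha *: a ord0.
  rewrite /Z big_nat1 big_geq // addr0; congr (_ + _ *: a _).
  by apply: val_inj; rewrite /= inordK.
pose z (j : 'I_m.+1) := Z j; pose v := gamma *: L q - u.
have an0 : alpha != 0 by rewrite gt_eqF.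
exists z, v; split; last first.
  suff -> : B_value v (fun=> q) (L q) = u by [].
  by apply: inner_inj => w; rewrite /B_value /v !innerE; ring.
move=> i; suff -> : A_value z v (fun=> q) (C_value (fun=> q)) i = a i by [].
suff argE : resolvent_arg z v (fun=> q) (C_value (fun=> q)) i - q =
    alpha *: a i.
  by rewrite /A_value argE scalerA mulVf // scale1r.
rewrite /resolvent_arg /C_value; have [j iE|->] := unliftP ord0 i; last first.
  by rewrite -{1}cur_ord0 unlift_cur subr0 /z Z0 addrC addKr.
have [jm|jm] := eqVneq (j : nat) m.
  have -> : i = ord_max by rewrite iE; apply: val_inj; rewrite /= jm.
  have -> : gamma *: L q - v = u by rewrite /v opprB addrC subrK.
  have aE : \sum_i a i = \sum_(0 <= l < m.+1) a (inord l) + a ord_max.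
    rewrite big_mkord big_ord_recr /=; congr (_ + _); apply: eq_bigr => l _.
    by congr a; apply: val_inj; rewrite /= inordK // ltnW // ltnS.
  have CE : \sum_j C j q = \sum_(0 <= l < m) C (inord l) q + C j q.
    rewrite big_mkord big_ord_recr /=; congr (_ + C _ q); last exact: val_inj.
    apply: eq_bigr => l _; congr (C _ q).
    by apply: val_inj; rewrite /= inordK // ltnW // ltnS.
  have -> : a ord_max = - (\sum_(0 <= l < m.+1) a (inord l) + adjoint L u
      + (\sum_(0 <= l < m) C (inord l) q + C j q)).
    apply/eqP; rewrite -addr_eq0 -CE !addrA [a ord_max + _]addrC -aE.
    exact/eqP.
  rewrite unlift_none /z jm /Z; apply: inner_inj => w.
  by rewrite !innerE; ring.
have jm' : (j.+1 < m.+1)%N by rewrite ltnS ltn_neqAle jm -ltnS ltn_ord.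
have -> : i = cur (Ordinal jm') by rewrite iE; exact: val_inj.
rewrite unlift_cur /z /= ZS inord_val.
have -> : inord j.+1 = cur (Ordinal jm') :> 'I_m.+2.
  by apply: val_inj; rewrite /= inordK // ltnW.
by apply: inner_inj => w; rewrite !innerE; ring.
Qed.

(** * Convergence of the iteration *)

Section ClusterExistence.
Variable b : 'I_m.+1 -> R.
Hypothesis b_gt0 : forall j, 0 < b j.
Hypothesis hC : forall j, cocoercive (b j)^-1 (C j).
Variables (U : set_system nat) (zs : nat -> 'I_m.+1 -> H) (vs : nat -> G).
Variables (xs : nat -> 'I_m.+2 -> H) (ys : nat -> G).
Context {UU : UltraFilter U}.
Hypothesis sol : forall k, solves (zs k) (vs k) (xs k) (ys k).
Hypothesis jump0 : forall j, jump (xs k) j @[k --> U] --> (0 : H).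
Hypothesis gap0 : gap (xs k) (ys k) @[k --> U] --> (0 : G).

Lemma cluster_exists (Mz Mv Mx : R) :
  (forall k j, `|zs k j| <= Mz) -> (forall k, `|vs k| <= Mv) ->
  (forall k, `|xs k ord0| <= Mx) ->
  exists zb vb xb,
    [/\ solves zb vb (fun=> xb) (L xb),
        (forall j, bweak U (fun k => zs k j) (zb j)) /\ bweak U vs vb,
        forall i, bweak U (fun k => xs k i) xb,
        bweak U ys (L xb) &
        forall i, inner (xs k i - xb)
          (A_value (zs k) (vs k) (xs k) (C_value (xs k)) i
           - A_value zb vb (fun=> xb) (C_value (fun=> xb)) i)
          @[k --> U] --> (0 : R)].
Proof.
move=> zM vM xM.
have PU : ProperFilter U by exact: ultra_proper.
have /choice[zb z_lim] : forall j, exists l, bweak U (fun k => zs k j) l.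
  by move=> j; apply: ultra_bweak; apply: nearW => k; exact: zM.
have [vb v_lim] : exists l, bweak U vs l.
  by apply: ultra_bweak; apply: nearW => k; exact: vM.
have [xb x0_lim] : exists l, bweak U (fun k => xs k ord0) l.
  by apply: ultra_bweak; apply: nearW => k; exact: xM.
have /choice[cb c_lim] : forall j, exists l,
    bweak U (fun k => C_value (xs k) j) l.
  move=> j; have [[M xjM] _] := x_lim jump0 x0_lim (cur j).
  apply: (@ultra_bweak _ _ _ _ (`|C j 0| + b j * M)).
  apply: filterS xjM => k xk; rewrite /C_value -{1}(subrK (C j 0) (C j _)).
  rewrite addrC (le_trans (ler_normD _ _)) // lerD2l.
  have bj : 0 < (b j)^-1 by rewrite invr_gt0.
  rewrite (le_trans (cocoercive_lipschitz bj (hC j) _ _)) // invrK subr0.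
  by rewrite ler_wpM2l // ltW.
have cluster := cluster_solves b_gt0 hC sol jump0 gap0 z_lim v_lim x0_lim c_lim.
have [_ cE _] :=
  cluster_inclusions b_gt0 hC sol jump0 gap0 z_lim v_lim x0_lim c_lim.
have cbE : cb = C_value (fun=> xb) by apply/funext => j; rewrite cE.
rewrite cbE in c_lim.
exists zb, vb, xb; split=> //.
- exact: cluster.
- by move=> i; exact: x_lim.
- by apply: y_lim; [exact: jump0|exact: gap0|exact: x0_lim].
- move=> i.
  by apply: (cluster_product b_gt0 hC sol jump0 gap0 z_lim v_lim x0_lim c_lim).
Qed.

End ClusterExistence.

Section Iteration.
Variables (b : 'I_m.+1 -> R) (beta lambda : R).
Hypothesis b_gt0 : forall j, 0 < b j.
Hypothesis b_le : forall j, b j <= beta.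
Hypothesis hC : forall j, cocoercive (b j)^-1 (C j).
Hypothesis gammaL : alpha * gamma * opnorm L ^+ 2 <= 1.
Hypothesis lambda_gt0 : 0 < lambda.
Hypothesis lambda_lt : lambda < 1 - alpha * beta / 2.
Variable w0 : ('I_m.+1 -> H) * G.

Let w_ k := iter k (T A B C L alpha gamma lambda) w0.
Let x_ k := xstep A C L alpha gamma (w_ k).
Let y_ k := ystep A B C L alpha gamma (w_ k).
Let D_ z v k := sqdist (fun j => (w_ k).1 j - z j) ((w_ k).2 - v).
Let rate := lambda * (1 - alpha * beta / 2 - lambda).

Lemma rate_gt0 : 0 < rate.
Proof. by rewrite mulr_gt0 // subr_gt0. Qed.

Lemma D_decrease z v q k : solves z v (fun=> q) (L q) ->
  D_ z v k.+1 <= D_ z v k - rate * defect (x_ k) (y_ k).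
Proof. by move=> /(T_fejer b_gt0 b_le hC gammaL lambda_gt0 (w_ k)). Qed.

Lemma D_nonincreasing z v q : solves z v (fun=> q) (L q) ->
  nonincreasing_seq (D_ z v).
Proof.
move=> sol; apply/nonincreasing_seqP => k; apply: le_trans (D_decrease k sol) _.
by rewrite gerBl mulr_ge0 ?defect_ge0 // ltW // rate_gt0.
Qed.

Lemma D_cvg z v q : solves z v (fun=> q) (L q) -> cvgn (D_ z v).
Proof.
move=> sol; apply: nonincreasing_is_cvgn (D_nonincreasing sol) _.
by exists 0 => _ [k _ <-]; exact: sqdist_ge0.
Qed.

(** The defect is proportional to the squared distance between consecutive
    iterates, and the step is nonexpansive. *)
Lemma defect_nonincreasing k :
  defect (x_ k.+1) (y_ k.+1) <= defect (x_ k) (y_ k).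
Proof.
have := T_nonexpansive b_gt0 b_le hC gammaL lambda_gt0 (w_ k) (w_ k.+1)
  (ltW lambda_lt).
have res j :
    sqdist (fun i => (w_ j).1 i - (w_ j.+1).1 i) ((w_ j).2 - (w_ j.+1).2) =
    lambda ^+ 2 * defect (x_ j) (y_ j) by exact: T_residual.
by rewrite -![T _ _ _ _ _ _ _ (w_ _)]/(w_ _.+1) !res ler_pM2l // exprn_gt0.
Qed.

Variables (zs : 'I_m.+1 -> H) (vs : G) (qs : H).
Hypothesis sols : solves zs vs (fun=> qs) (L qs).

Lemma defect_littleo : k.+1%:R * defect (x_ k) (y_ k) @[k --> \oo] --> (0 : R).
Proof.
apply: (@summable_nonincreasing_littleo _ _ (D_ zs vs 0%N / rate)).
- by move=> k; exact: defect_ge0.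
- exact: defect_nonincreasing.
- move=> n; rewrite ler_pdivlMr ?rate_gt0 // mulrC.
  suff : rate * (\sum_(k < n) defect (x_ k) (y_ k)) <= D_ zs vs 0%N - D_ zs vs n.
    by move=> /le_trans; apply; rewrite gerBl sqdist_ge0.
  elim: n => [|n IH]; first by rewrite big_ord0 mulr0 subrr.
  by rewrite big_ord_recr /= mulrDr; have := D_decrease n sols; lra.
Qed.

Lemma defect_cvg0 : defect (x_ k) (y_ k) @[k --> \oo] --> (0 : R).
Proof.
apply: (squeeze_cvgr _ (cvg_cst 0) defect_littleo).
apply: nearW => k; rewrite defect_ge0 /= ler_peMl ?defect_ge0 //.
by rewrite ler1n.
Qed.

Lemma jump_cvg0 j : jump (x_ k) j @[k --> \oo] --> (0 : H).
Proof.
apply: cvg0_of_sqr_norm; apply: (squeeze_cvgr _ (cvg_cst 0) defect_cvg0).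
apply: nearW => k; rewrite sqr_ge0 /= /defect (bigD1 j) //= -addrA lerDl.
apply: addr_ge0; first by apply: sumr_ge0 => i _; exact: sqr_ge0.
by rewrite !mulr_ge0 ?sqr_ge0 // ltW.
Qed.

Lemma gap_cvg0 : gap (x_ k) (y_ k) @[k --> \oo] --> (0 : G).
Proof.
have ag : 0 < alpha * gamma by rewrite mulr_gt0.
have lim : (alpha * gamma)^-1 * defect (x_ k) (y_ k) @[k --> \oo] --> (0 : R).
  by rewrite -(mulr0 (alpha * gamma)^-1); apply: cvgM defect_cvg0; exact: cvg_cst.
apply: cvg0_of_sqr_norm; apply: (squeeze_cvgr _ (cvg_cst 0) lim).
apply: nearW => k; rewrite sqr_ge0 /= ler_pdivlMl // /defect lerDr.
by apply: sumr_ge0 => i _; exact: sqr_ge0.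
Qed.

Lemma w1_bounded k j : `|(w_ k).1 j| <= \sum_i `|zs i| + (D_ zs vs 0%N + 1).
Proof.
rewrite -(subrK (zs j) ((w_ k).1 j)) addrC (le_trans (ler_normD _ _)) // lerD //.
  by rewrite (bigD1 j) //= lerDl sumr_ge0.
apply: norm_le_of_sqr; apply: (@le_trans _ _ (D_ zs vs k)).
  rewrite /D_ /sqdist (bigD1 j) //= -addrA lerDl.
  apply: addr_ge0; first by apply: sumr_ge0 => i _; exact: sqr_ge0.
  by rewrite mulr_ge0 ?sqr_ge0 // divr_ge0 // ltW.
exact: D_nonincreasing sols _ _ _.
Qed.

Lemma w2_bounded k : `|(w_ k).2| <= `|vs| + (gamma / alpha * D_ zs vs 0%N + 1).
Proof.
rewrite -(subrK vs (w_ k).2) addrC (le_trans (ler_normD _ _)) // lerD2l.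
have ag : 0 < gamma / alpha by rewrite divr_gt0.
apply: norm_le_of_sqr; apply: (@le_trans _ _ (gamma / alpha * D_ zs vs k)).
  rewrite -ler_pdivrMl // invf_div /D_ /sqdist lerDr.
  by apply: sumr_ge0 => i _; exact: sqr_ge0.
by rewrite ler_pM2l //; exact: D_nonincreasing sols _ _ _.
Qed.

(** [x_ k ord0] is the resolvent of [A ord0] at [(w_ k).1 ord0], and resolvents
    are nonexpansive. *)
Lemma x0_bounded k :
  `|x_ k ord0| <= `|qs| + (D_ zs vs 0%N + 1).
Proof.
rewrite -(subrK qs (x_ k ord0)) addrC (le_trans (ler_normD _ _)) // lerD2l.
apply: (@le_trans _ _ `|(w_ k).1 ord0 - zs ord0|); last first.
  apply: norm_le_of_sqr; apply: (@le_trans _ _ (D_ zs vs k)).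
    rewrite /D_ /sqdist (bigD1 ord0) //= -addrA lerDl.
    apply: addr_ge0; first by apply: sumr_ge0 => i _; exact: sqr_ge0.
    by rewrite mulr_ge0 ?sqr_ge0 // divr_ge0 // ltW.
  exact: D_nonincreasing sols _ _ _.
have a0 z v x c : A_value z v x c ord0 = alpha^-1 *: (z ord0 - x ord0).
  rewrite /A_value /resolvent_arg unlift_none -cur_ord0 unlift_cur subr0.
  by rewrite cur_ord0.
have [solA _] := step_solves (w_ k); have [sA _] := sols.
have := (hA ord0).1 _ _ _ _ (solA ord0) (sA ord0).
rewrite !a0 -scalerBr innerZr pmulr_rge0 ?invr_gt0 // -/(x_ k) => mon.
have [->|ne0] := eqVneq (x_ k ord0 - qs) 0; first by rewrite normr0.
rewrite -(@ler_pM2l _ `|x_ k ord0 - qs|) ?normr_gt0 //.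
apply: le_trans (cauchy_schwarz _ _); rewrite -expr2 -inner_norm.
rewrite -subr_ge0 -innerNr -innerDr.
suff -> : (w_ k).1 ord0 - zs ord0 - (x_ k ord0 - qs) =
  (w_ k).1 ord0 - x_ k ord0 - (zs ord0 - qs) by [].
by rewrite !opprD addrACA.
Qed.

Lemma iteration_cluster (U : set_system nat) :
  UltraFilter U -> \oo `<=` U ->
  exists zb vb xb,
    [/\ solves zb vb (fun=> xb) (L xb),
        (forall j, bweak U (fun k => (w_ k).1 j) (zb j))
        /\ bweak U (fun k => (w_ k).2) vb,
        forall i, bweak U (fun k => x_ k i) xb,
        bweak U y_ (L xb) &
        forall i, inner (x_ k i - xb)
          (A_value (w_ k).1 (w_ k).2 (x_ k) (C_value (x_ k)) i
           - A_value zb vb (fun=> xb) (C_value (fun=> xb)) i)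
          @[k --> U] --> (0 : R)].
Proof.
move=> UU ooU.
apply: (cluster_exists b_gt0 hC _ _ _ w1_bounded w2_bounded x0_bounded).
- by move=> k; exact: step_solves.
- by move=> j V nV; apply: ooU; exact: jump_cvg0.
- by move=> V nV; apply: ooU; exact: gap_cvg0.
Qed.

(** Opial's argument: the difference of the squared distances to two solutions
    is an affine function of the iterates, and it converges; so it takes the
    same value at both weak cluster points, which makes their distance zero. *)
Lemma cluster_unique U1 U2 z1 v1 q1 z2 v2 q2 :
  ProperFilter U1 -> ProperFilter U2 -> \oo `<=` U1 -> \oo `<=` U2 ->
  solves z1 v1 (fun=> q1) (L q1) -> solves z2 v2 (fun=> q2) (L q2) ->
  (forall j, bweak U1 (fun k => (w_ k).1 j) (z1 j)) ->
  bweak U1 (fun k => (w_ k).2) v1 ->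
  (forall j, bweak U2 (fun k => (w_ k).1 j) (z2 j)) ->
  bweak U2 (fun k => (w_ k).2) v2 ->
  [/\ z1 = z2, v1 = v2 & q1 = q2].
Proof.
move=> PU1 PU2 oo1 oo2 sol1 sol2 zl1 vl1 zl2 vl2.
pose form (z : 'I_m.+1 -> H) (v : G) :=
  \sum_j inner (z j) (z1 j - z2 j) + alpha / gamma * inner v (v1 - v2).
pose c := \sum_j (`|z1 j| ^+ 2 - `|z2 j| ^+ 2)
  + alpha / gamma * (`|v1| ^+ 2 - `|v2| ^+ 2).
have formE k : form (w_ k).1 (w_ k).2 = 2^-1 * (D_ z2 v2 k - D_ z1 v1 k + c).
  have -> : D_ z2 v2 k - D_ z1 v1 k + c =
      \sum_j 2 * inner ((w_ k).1 j) (z1 j - z2 j)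
      + 2 * (alpha / gamma * inner (w_ k).2 (v1 - v2)).
    rewrite /D_ /sqdist /c.
    have sq (V : hilbertType R) (u a d : V) : 2 * inner u (a - d) =
        `|u - d| ^+ 2 - `|u - a| ^+ 2 + (`|a| ^+ 2 - `|d| ^+ 2).
      by rewrite -!inner_norm !innerE [inner a u]innerC [inner d u]innerC; ring.
    under [in RHS]eq_bigr do rewrite sq.
    rewrite [2 * (_ * _)]mulrCA sq.
    by rewrite !big_split /= !sumrN; ring.
  by rewrite /form -mulr_sumr -mulrDr mulrA mulVf ?mul1r.
have form_cvg : form (w_ k).1 (w_ k).2 @[k --> \oo] -->
    2^-1 * (limn (D_ z2 v2) - limn (D_ z1 v1) + c).
  under eq_fun do rewrite formE; apply: cvgM; first exact: cvg_cst.
  apply: cvgD; last exact: cvg_cst.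
  by apply: cvgB; [exact: D_cvg sol2|exact: D_cvg sol1].
have form_lim (U : set_system nat) z v : ProperFilter U -> \oo `<=` U ->
    (forall j, bweak U (fun k => (w_ k).1 j) (z j)) ->
    bweak U (fun k => (w_ k).2) v ->
    form z v = 2^-1 * (limn (D_ z2 v2) - limn (D_ z1 v1) + c).
  move=> PU ooU zl vl.
  have lim1 : form (w_ k).1 (w_ k).2 @[k --> U] --> form z v.
    apply: cvgD; first by apply: cvg_sumr => j; have [_ h] := zl j; exact: h.
    by apply: cvgM; [exact: cvg_cst|have [_ h] := vl; exact: h].
  have lim2 : form (w_ k).1 (w_ k).2 @[k --> U] -->
      2^-1 * (limn (D_ z2 v2) - limn (D_ z1 v1) + c).
    by move=> V nV; apply: ooU; exact: form_cvg.
  exact: (cvg_unique _ lim1 lim2).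
have same : form z1 v1 = form z2 v2.
  by rewrite (form_lim U1) // (form_lim U2).
have ag : 0 < alpha / gamma by rewrite divr_gt0.
have dist0 : sqdist (fun j => z1 j - z2 j) (v1 - v2) = 0.
  rewrite -[RHS](subrr (form z1 v1)) [X in _ = _ - X]same /form /sqdist.
  rewrite opprD addrACA -mulrBr -sumrB; congr (_ + _ * _).
    by apply: eq_bigr => j _; rewrite -inner_norm innerDl innerNl.
  by rewrite -inner_norm innerDl innerNl.
have s1 : 0 <= \sum_j `|z1 j - z2 j| ^+ 2.
  by apply: sumr_ge0 => j _; exact: sqr_ge0.
have s2 : 0 <= alpha / gamma * `|v1 - v2| ^+ 2.
  by rewrite mulr_ge0 ?sqr_ge0 // ltW.
move: dist0; rewrite /sqdist => /eqP; rewrite paddr_eq0 // => /andP[/eqP z0 v0].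
have vE : v1 = v2.
  apply/eqP; rewrite -subr_eq0 -normr_eq0 -sqrf_eq0.
  by move: v0; rewrite mulf_eq0 gt_eqF.
have zE : z1 = z2.
  apply/funext => j; apply/eqP; rewrite -subr_eq0 -normr_eq0 -sqrf_eq0.
  apply/eqP.
  by apply: (psumr_eq0P _ z0) => // i _; exact: sqr_ge0.
split=> //; have [e1 _] := solves_step sol1; have [e2 _] := solves_step sol2.
by move: e1 e2; rewrite zE vE => -> /(congr1 (fun f => f ord0)).
Qed.

Lemma iteration_limit : exists zb vb xb,
  solves zb vb (fun=> xb) (L xb) /\
  forall U, UltraFilter U -> \oo `<=` U ->
    [/\ (forall j, bweak U (fun k => (w_ k).1 j) (zb j))
        /\ bweak U (fun k => (w_ k).2) vb,
        forall i, bweak U (fun k => x_ k i) xb,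
        bweak U y_ (L xb) &
        forall i, inner (x_ k i - xb)
          (A_value (w_ k).1 (w_ k).2 (x_ k) (C_value (x_ k)) i
           - A_value zb vb (fun=> xb) (C_value (fun=> xb)) i)
          @[k --> U] --> (0 : R)].
Proof.
have [U0 [UU0 oo0]] := eventually_ultra.
have [zb [vb [xb [sol [zl vl] _ _ _]]]] := iteration_cluster UU0 oo0.
exists zb, vb, xb; split=> // U UU ooU.
have [z [v [q [sol' [zl' vl'] xl yl prod]]]] := iteration_cluster UU ooU.
have PU0 : ProperFilter U0 by exact: ultra_proper.
have PU : ProperFilter U by exact: ultra_proper.
have [-> -> ->] := cluster_unique PU0 PU oo0 ooU sol sol' zl vl zl' vl'.
by split.
Qed.

End Iteration.
End Splitting.

(** * The convergence theorem *)

Section LittleO.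
Variable R : realType.

Lemma sqrt_littleo (f : nat -> R) (theta s : R) : 0 < theta -> 0 < s ->
  (forall k, 0 <= f k) -> k.+1%:R * f k @[k --> \oo] --> (0 : R) ->
  (fun k => Num.sqrt (f k)) =o_\oo
  (fun k => theta / Num.sqrt (s * k.+1%:R)).
Proof.
move=> theta0 s0 f0 lim; apply/eqoP => e e0.
have d0 : 0 < (e * theta) ^+ 2 / s by rewrite divr_gt0 // exprn_gt0 // mulr_gt0.
apply: filterS (cvgr0_norm_le _ lim _ d0) => k.
rewrite ger0_norm ?mulr_ge0 // => h.
have sk : 0 < s * k.+1%:R by rewrite mulr_gt0.
have -> : `|Num.sqrt (f k)| = Num.sqrt (f k) by rewrite ger0_norm ?sqrtr_ge0.
have -> : `|theta / Num.sqrt (s * k.+1%:R)| = theta / Num.sqrt (s * k.+1%:R).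
  by rewrite gtr0_norm // divr_gt0 // sqrtr_gt0.
rewrite mulrA ler_pdivlMr ?sqrtr_gt0 // -sqrtrM //.
have et : 0 < e * theta by rewrite mulr_gt0.
rewrite -[leRHS]gtr0_norm // -sqrtr_sqr ler_sqrt ?sqr_ge0 //.
by rewrite ler_pdivlMr // in h; rewrite mulrCA mulrC [f k * _]mulrC.
Qed.

End LittleO.

Theorem theorem3p1 (R : realType) (H G : hilbertType R) (m : nat)
    (A : 'I_m.+2 -> H -> set H) (B : G -> set G) (C : 'I_m.+1 -> H -> H)
    (betas : 'I_m.+1 -> R) (L : {linear H -> G})
    (alpha gamma lambda : R) (z0 : 'I_m.+1 -> H) (v0 : G)
    (hA : forall i, maximally_monotone (A i))
    (hB : maximally_monotone B)
    (hbetas : forall k, 0 < betas k)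
    (hC : forall k, cocoercive (betas k)^-1 (C k))
    (hL : bounded_near L (nbhs (0 : H)))
    (hP : primal A B C L !=set0) :
  let beta := \big[Num.max/betas ord0]_k betas k in
  0 < alpha < 2 / beta ->
  0 < gamma ->
  (opnorm L != 0 ->
     gamma < (1 - 2^-1 * alpha * beta) / (alpha * opnorm L ^+ 2)) ->
  0 < lambda < 1 - alpha * beta / 2 ->
  let theta := lambda / (1 - alpha * beta / 2) in
  let step := T A B C L alpha gamma lambda in
  let zv k := iter k step (z0, v0) in
  let v k := (zv k).2 in
  let x k := xstep A C L alpha gamma (zv k) in
  let y k := ystep A B C L alpha gamma (zv k) in
  exists (zbar : 'I_m.+1 -> H) (vbar : G) (xbar : H),
    [/\ Fix step (zbar, vbar) /\
        weak_cvg (@prod_inner R H G m.+1) zv (zbar, vbar),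
        primal A B C L xbar /\
        weak_cvg (@prod_inner R H G m.+2)
          (fun k => (x k, y k)) (fun=> xbar, L xbar),
        dual A B C L (gamma *: L xbar - vbar) /\
        (forall i, weak_cvg (@inner R G)
           (fun k => gamma *: L (x k i) - v k) (gamma *: L xbar - vbar)),
        (fun k => weighted_norm (alpha / gamma) (zv k - zv k.+1))
          =o_\oo (fun k => theta / Num.sqrt (theta * (1 - theta) * k.+1%:R)) &
        forall i, uniformly_monotone (A i) ->
          x k i @[k --> \oo] --> xbar].
Proof.
move=> beta alpha_bnd gamma_gt0 gamma_lt lambda_bnd theta step zv v x y.
case/andP: alpha_bnd => alpha_gt0 alpha_lt.
case/andP: lambda_bnd => lambda_gt0 lambda_lt.
have b_le k : betas k <= beta by exact: le_bigmax.
have beta_gt0 : 0 < beta by exact: lt_le_trans (hbetas ord0) (b_le ord0).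
have kappa_gt0 : 0 < 1 - alpha * beta / 2 by exact: lt_trans lambda_lt.
have kappa_lt1 : 1 - alpha * beta / 2 < 1.
  by rewrite gtrBl divr_gt0 // mulr_gt0.
have gammaL : alpha * gamma * opnorm L ^+ 2 <= 1.
  have [->|n0] := eqVneq (opnorm L) 0; first by rewrite expr0n mulr0.
  have L2 : 0 < alpha * opnorm L ^+ 2.
    by rewrite mulr_gt0 // exprn_gt0 // lt_neqAle eq_sym n0 opnorm_ge0.
  have := gamma_lt n0; rewrite ltr_pdivlMr // => lt.
  have -> : alpha * gamma * opnorm L ^+ 2 = gamma * (alpha * opnorm L ^+ 2).
    by ring.
  by apply: ltW; apply: lt_trans lt _; move: kappa_lt1; lra.
have [q /(primal_solves gamma alpha_gt0)[zs [vs sols]]] := hP.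
have [zbar [vbar [xbar [sol lim]]]] :=
  iteration_limit hA hB hL alpha_gt0 gamma_gt0 hbetas b_le hC gammaL
    lambda_gt0 lambda_lt (z0, v0) sols.
rewrite -/step -/zv in lim.
exists zbar, vbar, xbar; split.
- split.
    by have [eT _ _] := solves_fixed hA hB alpha_gt0 gamma_gt0 lambda sol.
  move=> w; apply: cvg_ultra => U UU ooU; have [[zl [_ vl]] _ _ _] := lim U UU ooU.
  apply: cvgD; last exact: vl.
  by apply: cvg_sumr => i; have [_ h] := zl i; exact: h.
- split; first exact: (solves_primal hL alpha_gt0 sol).
  move=> w; apply: cvg_ultra => U UU ooU; have [_ xl [_ yl] _] := lim U UU ooU.
  apply: cvgD; last exact: yl.
  by apply: cvg_sumr => i; have [_ h] := xl i; exact: h.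
- split; first exact: (solves_dual hL alpha_gt0 sol).
  move=> i w; apply: cvg_ultra => U UU ooU; have [[_ vl] xl _ _] := lim U UU ooU.
  have PU : ProperFilter U by exact: ultra_proper.
  have Lx := [elaborate bweakL hL (xl i)].
  have [_ h] := [elaborate bweakB (bweakZ gamma Lx) vl].
  exact: h.
- have theta_gt0 : 0 < theta by rewrite divr_gt0.
  have theta_lt1 : theta < 1 by rewrite ltr_pdivrMr // mul1r.
  have sg : 0 < theta * (1 - theta) by rewrite mulr_gt0 // subr_gt0.
  have -> : (fun k => weighted_norm (alpha / gamma) (zv k - zv k.+1)) =
      fun k => Num.sqrt (lambda ^+ 2 * defect L alpha gamma (x k) (y k)).
    by apply/funext => k; congr Num.sqrt; exact: T_residual.
  apply: sqrt_littleo => // [k|].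
    by rewrite mulr_ge0 ?sqr_ge0 // defect_ge0.
  have lim0 : k.+1%:R * defect L alpha gamma (x k) (y k) @[k --> \oo] --> (0 : R).
    exact: (defect_littleo hA hB hL alpha_gt0 gamma_gt0 hbetas b_le hC gammaL
             lambda_gt0 lambda_lt (z0, v0) sols).
  under eq_fun do rewrite mulrCA.
  by rewrite -(mulr0 (lambda ^+ 2)); apply: cvgM lim0; exact: cvg_cst.
- move=> i Ai_unif; apply: cvg_ultra => U UU ooU.
  have PU : ProperFilter U by exact: ultra_proper.
  have [_ _ _ prod] := lim U UU ooU.
  apply: uniformly_monotone_cvg Ai_unif _ _ (prod i) => [k|].
    have [sA _] := step_solves C L hA hB alpha_gt0 gamma_gt0 (zv k); exact: sA.
  by have [sA _] := sol; exact: sA.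
Qed.
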